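(* Consider the drifted Brownian motion inventory model with the ordering policy $(\tau,Y)$ described in the context, let $X$ be the resulting inventory process, and let $\{\mu_{0,t}\}$ and $\{\mu_{1,t}\}$ be the corresponding average expected occupation measures and average expected ordering measures. Then: (a) $J_0(\tau,Y)<\infty$; (b) $\{\mu_{0,t}:t>0\}$ is tight as $t\to\infty$; and (c) $\{\mu_{1,t}:t>0\}$ is not tight.
   Context: Model. Without orders the inventory level is $X_0(t)=W(t)-t$, $t\ge 0$, with $W$ a standard Brownian motion. An ordering policy is a sequence of order times and nonnegative order sizes $(\tau,Y)=\{(\tau_k,Y_k)\}$, and the inventory process (with values in $\mathbb R$, initial level $0$ before any order) is $$X(t)=W(t)-t+\sum_{k}I_{\{\tau_k\le t\}}Y_k,\qquad t\ge 0.$$ $X$ is constructed by piecing together independent copies of $X_0$ at the order times, so the pieces between consecutive distinct order times are independent. Policy. Orders are indexed by pairs $(i,j)$: cycle $i=1,2,3,\dots$ and order number $j=1,\dots,2^i+1$ within cycle $i$ (listed lexicographically this gives the single-index sequence $(\tau_k,Y_k)$). Set $\tau_{1,1}=0$ and, for $i\ge2$, $\tau_{i,1}=\inf\{t\ge\tau_{i-1,2^{i-1}+1}:X(t)=0\}$. For each $i\ge1$: Phase 1: $Y_{i,1}=1$, and for $j=2,\dots,2^{i-1}$, $\tau_{i,j}=\inf\{t\ge\tau_{i,j-1}:X(t)=0\}$, $Y_{i,j}=1$. Phase 2: $\tau_{i,2^{i-1}+1}=\inf\{t\ge\tau_{i,2^{i-1}}:X(t)=0\}$, $Y_{i,2^{i-1}+1}=2^{(i-1)/2}$;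 and for $j=2^{i-1}+2,\dots,2^i+1$, $\tau_{i,j}=\tau_{i,2^{i-1}+1}$, $Y_{i,j}=0$. (Each infimum refers to the process $X$ after the preceding orders have been applied.) So in cycle $i$ the level is raised from $0$ to $1$ a total of $2^{i-1}$ times, then raised once from $0$ to $2^{(i-1)/2}$, immediately followed by $2^{i-1}$ orders of size $0$. Convention. For an order $k$, $(X(\tau_k-),X(\tau_k))$ denotes the inventory levels just before and just after that particular order; when several orders are placed at the same time they are applied one after another. Thus each $0$-size order of cycle $i$ contributes the pair $(2^{(i-1)/2},2^{(i-1)/2})$, the preceding large order contributes $(0,2^{(i-1)/2})$, and each order of Phase 1 (including the one at time $0$) contributes $(0,1)$. Costs. $c_0(x)=2|x|$ for $x\in\mathbb R$; $\overline{\mathcal R}=\{(y,z)\in\mathbb R^2:y\le z\}$; $c_1(y,z)=k_1+(z-y)$ on $\overline{\mathcal R}$ with constant $k_1>0$ (orders of size $0$ cost $k_1$). The long-term average cost is $$J_0(\tau,Y)=\limsup_{t\to\infty}\frac1t\,\mathbb E\Big[\int_0^tc_0(X(s))\,ds+\sum_{k}I_{\{\tau_k\le t\}}c_1(X(\tau_k-),X(\tau_k))\Big].$$ Measures. For $t>0$, $$\mu_{0,t}(\Gamma_0)=\frac1t\mathbb E\Big[\int_0^tI_{\Gamma_0}(X(s))\,ds\Big]\ (\Gamma_0\in\mathcal B(\mathbb R)),\qquad \mu_{1,t}(\Gamma_1)=\frac1t\mathbb E\Big[\sum_kI_{\{\tau_k\le t\}}I_{\Gamma_1}(X(\tau_k-),X(\tau_k))\Big]\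 (\Gamma_1\in\mathcal B(\overline{\mathcal R})).$$ Tightness. $\{\mu_{0,t}\}$ is tight as $t\to\infty$ if for each $\epsilon>0$ there are a compact $\Gamma\subset\mathbb R$ and $T<\infty$ with $\mu_{0,t}(\Gamma^c)<\epsilon$ for all $t\ge T$. $\{\mu_{1,t}\}$ is not tight if for some $\epsilon>0$ and every compact $\Gamma\subset\overline{\mathcal R}$ there is some $t$ in the index set with $\mu_{1,t}(\Gamma^c)>\epsilon$. *)

(* Defs.v *)
From HB Require Import structures.
From mathcomp Require Import all_boot all_order all_algebra.
From mathcomp Require Import all_classical all_reals all_analysis.
Set Implicit Arguments.
Unset Strict Implicit.
Unset Printing Implicit Defensive.
Import Order.TTheory GRing.Theory Num.Theory.
Import numFieldNormedType.Exports.
Local Open Scope classical_set_scope.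
Local Open Scope ring_scope.

Section BrownianMotion.
Context (R : realType) (d : measure_display) (Omega : measurableType d).
Variable P : probability Omega R.

(* Product rule over initial segments. For families [F k] that contain [setT]
   (as sigma-algebras do) this is the product rule over all finite subfamilies. *)
Definition mutually_independent (F : nat -> set (set Omega)) : Prop :=
  forall (n : nat) (E : nat -> set Omega),
    (forall i, (i < n)%N -> F i (E i)) ->
    (P (\bigcap_(i in `I_n) E i) = \prod_(i < n) P (E i))%E.

Definition sigma_of_variable (X : Omega -> R) : set (set Omega) :=
  preimage_set_system setT X measurable.

(* The time index set is [0, +oo[: values at negative times play no role. *)
Definition sigma_of_process (Z : R -> Omega -> R) : set (set Omega) :=
  <<s \bigcup_(t in [set t : R | 0 <= t]) sigma_of_variable (Z t) >>.

(* [normal_prob m s] is parametrized by the standard deviation [s], and is the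
   Gaussian law only for [s != 0], whence the strict inequality [s < t]. *)
Record standard_brownian_motion (W : R -> {RV P >-> R}) : Prop := {
  bm_start : forall w, W 0 w = 0 ;
  bm_continuous : forall w, {within [set t : R | 0 <= t], continuous (W ^~ w)} ;
  bm_gaussian : forall (s t : R) (A : set R), 0 <= s -> s < t -> measurable A ->
    P ((fun w => W t w - W s w) @^-1` A) = normal_prob 0 (Num.sqrt (t - s)) A ;
  bm_independent : forall t : nat -> R, 0 <= t 0%N -> nondecreasing_seq t ->
    mutually_independent
      (fun i => sigma_of_variable (fun w => W (t i.+1) w - W (t i) w))
}.

End BrownianMotion.

Section OrderIndex.

(* [(i, j)] is order [j] of cycle [i], with 1 <= i and 1 <= j <= 2 ^ i + 1. *)
Definition next_order (ij : nat * nat) : nat * nat :=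
  if (ij.2 < 2 ^ ij.1 + 1)%N then (ij.1, ij.2.+1) else (ij.1.+1, 1%N).

Definition order_index (k : nat) : nat * nat := iter k next_order (1%N, 1%N).

Definition order_size {R : realType} (k : nat) : R :=
  let: (i, j) := order_index k in
  if (j <= 2 ^ i.-1)%N then 1
  else if j == (2 ^ i.-1).+1 then 2 `^ (i.-1%:R / 2)
  else 0.

(* The 0-size orders, placed at the time of the preceding order. *)
Definition simultaneous_order (k : nat) : bool :=
  let: (i, j) := order_index k in ((2 ^ i.-1).+1 < j)%N.

End OrderIndex.

Section Path.
Context {R : realType}.
Implicit Types (x : R -> R) (tau : \bar R).

(* inf {t >= tau : x t = 0}, equal to +oo when the set is empty. *)
Definition hitting_time_after tau x : \bar R :=
  ereal_inf [set t%:E | t in [set t : R | (tau <= t%:E)%E /\ x t = 0]].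

Definition apply_order x tau (y : R) : R -> R :=
  fun t => x t + (if (tau <= t%:E)%E then y else 0).

(* [policy x0 k] is the time of order [k] together with the inventory path
   obtained from the order-free path [x0] by applying orders [0], ..., [k]. *)
Fixpoint policy (x0 : R -> R) (k : nat) : \bar R * (R -> R) :=
  if k is k'.+1 then
    let: (tau', x) := policy x0 k' in
    let tau := if simultaneous_order k then tau' else hitting_time_after tau' x in
    (tau, apply_order x tau (order_size k))
  else (0%E, apply_order x0 0%E (order_size 0)).

Definition order_time_path (x0 : R -> R) k : \bar R := (policy x0 k).1.

(* The levels just before and just after order [k], simultaneous orders being
   applied one after another. Since [x0] is continuous, the path with only the
   orders [0], ..., [k - 1] applied takes at the time of order [k] the value
   X(tau_k -) of the sequential convention. The value at infinite order times
   is never used. *)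
Definition order_levels_path (x0 : R -> R) k : R * R :=
  let t := fine (order_time_path x0 k) in
  (if k is k'.+1 then (policy x0 k').2 t else x0 t, (policy x0 k).2 t).

End Path.

Section Inventory.
Context {R : realType} {T : Type}.
Variable W : R -> T -> R.

Definition inventory_without_orders (w : T) : R -> R := fun t => W t w - t.

Definition order_time (k : nat) (w : T) : \bar R :=
  order_time_path (inventory_without_orders w) k.

Definition order_levels (k : nat) (w : T) : R * R :=
  order_levels_path (inventory_without_orders w) k.

Definition inventory (t : R) (w : T) : R :=
  W t w - t +
  fine (\sum_(0 <= k <oo)
          (if order_time k w <= t%:E then (order_size k)%:E else 0))%E.

(* Between orders [k] and [k.+1], X runs as the copy [s |-> B k s - s] of the
   order-free process. The copies attached to orders [k] with
   [order_time k = order_time k.+1] are not used. *)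
Definition pieced_together (B : nat -> R -> T -> R) : Prop :=
  forall (w : T) (k : nat) (s : R), 0 <= s ->
    (order_time k w + s%:E < order_time k.+1 w)%E ->
    inventory (fine (order_time k w) + s) w =
    inventory (fine (order_time k w)) w + (B k s w - s).

End Inventory.

Section CostsAndMeasures.
Context {R : realType}.

Definition Rbar_set : set (R * R) := [set yz | yz.1 <= yz.2].

Definition c0 (x : R) : R := 2 * `|x|.

Definition c1 (k1 : R) (yz : R * R) : R := k1 + (yz.2 - yz.1).

Context {d : measure_display} {Omega : measurableType d}.
Variables (P : probability Omega R) (X : R -> Omega -> R).
Variables (tau : nat -> Omega -> \bar R) (levels : nat -> Omega -> R * R).

Local Open Scope ereal_scope.

Definition long_term_average_cost (k1 : R) : \bar R :=
  limf_esup (fun t : R => (t^-1)%:E *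
    \int[P]_w (\int[lebesgue_measure]_(s in `[0%R, t]) (c0 (X s w))%:E +
               \sum_(0 <= k <oo)
                 (if tau k w <= t%:E then (c1 k1 (levels k w))%:E else 0)))
    (pinfty_nbhs R).

Definition occupation_measure (t : R) (G : set R) : \bar R :=
  (t^-1)%:E *
  \int[P]_w \int[lebesgue_measure]_(s in `[0%R, t]) (\1_G (X s w))%:E.

Definition ordering_measure (t : R) (G : set (R * R)) : \bar R :=
  (t^-1)%:E *
  \int[P]_w \sum_(0 <= k <oo)
    (if tau k w <= t%:E then (\1_G (levels k w))%:E else 0).

End CostsAndMeasures.

Section Tightness.
Context {R : realType}.

Definition tight_at_infinity {S : topologicalType} (mu : R -> set S -> \bar R)
    : Prop :=
  forall eps : R, 0 < eps -> exists (G : set S) (t0 : R), compact G /\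
    forall t : R, 0 < t -> t0 <= t -> (mu t (~` G) < eps%:E)%E.

(* Measures on the subset [D] of [S], indexed by the times t > 0. *)
Definition not_tight_on {S : topologicalType} (D : set S)
    (mu : R -> set S -> \bar R) : Prop :=
  exists eps : R, 0 < eps /\
    forall G : set S, compact G -> G `<=` D ->
      exists t : R, 0 < t /\ (eps%:E < mu t (D `\` G))%E.

End Tightness.

(* Main.v *)
Require Import Defs.
From mathcomp Require Import all_boot all_order all_algebra.
From mathcomp Require Import all_classical all_reals all_analysis.
From mathcomp Require Import measurable_realfun ring lra zify.
Import Order.TTheory GRing.Theory Num.Theory.
Import numFieldNormedType.Exports.
Local Open Scope classical_set_scope.
Local Open Scope ring_scope.

(* With Z u = u - W u, order k is placed when Z first reaches a deterministic
   level, so at time s the inventory is at most the amount last filled up to plus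
   W s - W u - (s - u) for some u <= s. The second term has bounded expectation:
   a chaining bound linear in the fourth powers of dyadic increments controls W
   over windows of length 2 ^ k, where the drift dominates, so only the fourth
   moments of the increments are used. The first term is large only while Z climbs
   from some level a to a + 2 ^ (e / 2); this takes a time of about 2 ^ (e / 2), so
   its contribution is about 2 ^ e, comparable to the duration of cycle e. Hence the
   expected cost up to time t is of order t, which gives (a), and (b) by Markov's
   inequality. For (c), Z has with probability at least 1/2 reached the level of
   the large order of cycle e by time 10 * 2 ^ e, and then 2 ^ e orders have
   contributed the pair (2 ^ (e / 2), 2 ^ (e / 2)). *)

Set Implicit Arguments.
Unset Strict Implicit.
Unset Printing Implicit Defensive.

(** * Numbering of the orders by cycle and position *)

Lemma order_index_posS k : exists e j, [/\ order_index k = (e.+1, j),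
  (0 < j)%N, (j <= 2 ^ e.+1 + 1)%N & (k + 3 = 2 * 2 ^ e + e + j)%N].
Proof.
elim: k => [|k [e [j [ok j_gt0 jle ek]]]]; first by exists 0%N, 1%N.
have -> : order_index k.+1 = next_order (order_index k) by [].
rewrite ok /next_order /=; case: ltnP => h.
  by exists e, j.+1; split => //; lia.
by exists e.+1, 1%N; split => //; move: jle h ek; rewrite !expnS; lia.
Qed.

(** Cycles are counted from 0 from here on, so that cycle [e] has [2 ^ e] unit orders, a large order
    of size 2^(e/2) and [2 ^ e] orders of size 0. Positions within a cycle still start at 1. *)
Definition cycle k := (order_index k).1.-1.
Definition position k := (order_index k).2.

Lemma order_indexE k : order_index k = ((cycle k).+1, position k).
Proof. by rewrite /cycle /position; have [e [j [-> _ _ _]]] := order_index_posS k. Qed.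

Lemma position_gt0 k : (0 < position k)%N.
Proof. by rewrite /position; have [e [j [-> ? _ _]]] := order_index_posS k. Qed.

Lemma position_le k : (position k <= 2 ^ (cycle k).+1 + 1)%N.
Proof. by rewrite /position /cycle; have [e [j [-> _ ? _]]] := order_index_posS k. Qed.

(** The cycles before cycle [e] contain the sum over f < e of 2^(f+1) + 1, that is 2 * 2^e - 2 + e,
    orders. The rest of the 3 is due to [k] counting from 0 and positions from 1. *)
Lemma cycle_position k : (k + 3 = 2 * 2 ^ cycle k + cycle k + position k)%N.
Proof. by rewrite /position /cycle; have [e [j [-> _ _ ?]]] := order_index_posS k. Qed.

Lemma cycle_positionS k :
  if (position k < 2 ^ (cycle k).+1 + 1)%N
  then cycle k.+1 = cycle k /\ position k.+1 = (position k).+1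
  else cycle k.+1 = (cycle k).+1 /\ position k.+1 = 1%N.
Proof.
have : order_index k.+1 = next_order (order_index k) by [].
by rewrite !order_indexE /next_order /=; case: ifP => _ [-> ->].
Qed.

Lemma order_at e j : (0 < j)%N -> (j <= 2 ^ e.+1 + 1)%N ->
  exists k, cycle k = e /\ position k = j.
Proof.
elim: e j => [|e IHe]; elim=> // j IHj _ jle.
- have [->|j0] := eqVneq j 0%N; first by exists 0%N.
  have [k [ck pk]] : exists k, cycle k = 0%N /\ position k = j.
    by apply: IHj; [rewrite lt0n|rewrite ltnW].
  by exists k.+1; have := cycle_positionS k; rewrite pk ck jle.
- have [->|j0] := eqVneq j 0%N.
    have [//|//|k [ck pk]] := IHe (2 ^ e.+1 + 1)%N; first by rewrite addn1.
    by exists k.+1; have := cycle_positionS k; rewrite pk ck ltnn.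
  have [k [ck pk]] : exists k, cycle k = e.+1 /\ position k = j.
    by apply: IHj; [rewrite lt0n|rewrite ltnW].
  by exists k.+1; have := cycle_positionS k; rewrite pk ck jle.
Qed.

(** * Deterministic levels at which the orders are placed *)

Section Levels.
Context {R : realType}.

Definition big_size (e : nat) : R := 2 `^ (e%:R / 2).

Lemma big_size_gt0 e : 0 < big_size e.
Proof. exact: powR_gt0. Qed.

Lemma big_size_sqr e : big_size e ^+ 2 = 2 ^+ e.
Proof.
rewrite /big_size -powR_mulrn ?powR_ge0// -powRrM.
by rewrite -mulrA mulVf// mulr1 powR_mulrn.
Qed.

Lemma big_size_ge1 e : 1 <= big_size e.
Proof.
rewrite -(@ler_pXn2r _ 2)// ?nnegrE ?(ltW (big_size_gt0 _))// big_size_sqr expr1n.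
by rewrite exprn_ege1 ?ler1n.
Qed.

Lemma big_size_le e : big_size e <= 2 ^+ e.
Proof.
rewrite -big_size_sqr expr2 ler_peMr ?big_size_ge1// ltW// big_size_gt0//.
Qed.

(** A geometric sum of ratio sqrt 2, and 1 / (sqrt 2 - 1) < 4. The induction step compares squares,
    where it reads 25 * 2^e <= 32 * 2^e. *)
Lemma sum_big_size e : \sum_(f < e) big_size f <= 4 * big_size e.
Proof.
elim: e => [|e IH]; first by rewrite big_ord0 mulr_ge0// ltW// big_size_gt0.
rewrite big_ord_recr /= (le_trans (lerD IH (lexx _)))//.
rewrite -(@ler_pXn2r _ 2)// ?nnegrE; first last.
- by rewrite mulr_ge0// ltW// big_size_gt0.
- by rewrite addr_ge0 ?mulr_ge0// ltW// big_size_gt0.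
have -> : 4 * big_size e + big_size e = 5 * big_size e by ring.
rewrite !exprMn !big_size_sqr (exprS _ e).
have : 0 < (2 : R) ^+ e by rewrite exprn_gt0.
by move: (2 ^+ e) => x ?; nra.
Qed.

(* The total size of the orders of the cycles before cycle [e] (counted from 0). *)
Definition cycle_start (e : nat) : R := \sum_(f < e) (2 ^+ f + big_size f).

(** The value of Z u = u - W u at which order [k] is placed: X vanishes when Z equals the total size
    of the orders placed so far. The 0-size orders share the level of the large order before
    them. *)
Definition level k : R := cycle_start (cycle k) +
  (if (position k <= 2 ^ cycle k)%N then (position k).-1%:R else 2 ^+ cycle k).

(** The inventory just after order [k]. Unlike [order_size], it stays at the large size during the
    0-size orders. *)
Definition filling k : R :=
  if (position k <= 2 ^ cycle k)%N then 1 else big_size (cycle k).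

Definition total k : R := \sum_(j < k) order_size j.

Lemma order_sizeE k : order_size k =
  if (position k <= 2 ^ cycle k)%N then 1 else
  if position k == (2 ^ cycle k).+1 then big_size (cycle k) else 0 :> R.
Proof. by rewrite /order_size order_indexE. Qed.

Lemma simultaneous_orderE k :
  simultaneous_order k = ((2 ^ cycle k).+1 < position k)%N.
Proof. by rewrite /simultaneous_order order_indexE. Qed.

Lemma order_size_ge0 k : 0 <= order_size k :> R.
Proof.
by rewrite order_sizeE; case: ifP => // _; case: ifP => // _; exact/ltW/big_size_gt0.
Qed.

Lemma filling_gt0 k : 0 < filling k.
Proof. by rewrite /filling; case: ifP => // _; exact: big_size_gt0. Qed.

Lemma level0 : level 0 = 0.
Proof. by rewrite /level /cycle_start big_ord0 /= addr0. Qed.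

(** A 0-size order changes nothing, while any other order is placed once Z has used up the previous
    filling, and starts from an empty inventory. *)
Lemma level_filling_next k : [/\ simultaneous_order k.+1 -> level k.+1 = level k,
  simultaneous_order k.+1 -> filling k.+1 = filling k,
  simultaneous_order k.+1 -> order_size k.+1 = 0 :> R,
  ~~ simultaneous_order k.+1 -> level k.+1 = level k + filling k &
  ~~ simultaneous_order k.+1 -> order_size k.+1 = filling k.+1 :> R].
Proof.
have := cycle_positionS k; have := position_gt0 k; have := position_le k.
rewrite order_sizeE simultaneous_orderE /filling /level expnS.
move=> jle j0; case: ltnP => h [-> ->].
- have [h1|h1] := ltnP (2 ^ cycle k).+1 (position k).+1.
  + have h2 : (position k <= 2 ^ cycle k)%N = false by lia.
    have h3 : ((position k).+1 <= 2 ^ cycle k)%N = false by lia.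
    by rewrite h3 h2 gtn_eqF.
  + have h2 : (position k <= 2 ^ cycle k)%N by lia.
    rewrite h2; split => // _.
      case: ifP => h3; rewrite -addrA; congr (_ + _).
        by rewrite /= -[in LHS](prednK j0) -natr1.
      have e : position k = (2 ^ cycle k)%N by lia.
      by rewrite -natrX -e -[in LHS](prednK j0) natr1.
    case: ifP => // h3; suff -> : (position k).+1 == (2 ^ cycle k).+1 by [].
    by lia.
- have h1 : ((2 ^ (cycle k).+1).+1 < 1)%N = false by [].
  have h2 : (1 <= 2 ^ (cycle k).+1)%N by rewrite expn_gt0.
  have h3 : (position k <= 2 ^ cycle k)%N = false.
    have : (0 < 2 ^ cycle k)%N by rewrite expn_gt0.
    by move: h; clear; move: (2 ^ cycle k)%N => q; lia.
  rewrite h1 h2 h3; split => // _.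
  by rewrite /cycle_start big_ord_recr /= addr0 addrA.
Qed.

Lemma totalS k : total k.+1 = level k + filling k.
Proof.
elim: k => [|k IH].
  by rewrite /total big_ord_recr big_ord0 /= level0 order_sizeE /filling.
rewrite /total big_ord_recr /= -/(total k.+1) IH.
have [sim|nsim] := boolP (simultaneous_order k.+1).
  by have [/(_ sim) -> /(_ sim) -> /(_ sim) -> _ _] := level_filling_next k; rewrite addr0.
by have [_ _ _ /(_ nsim) -> /(_ nsim) ->] := level_filling_next k.
Qed.

Lemma levelS k : level k.+1 = if simultaneous_order k.+1 then level k else total k.+1.
Proof.
have [a _ _ b _] := level_filling_next k.
have [s|s] := boolP (simultaneous_order k.+1).
  exact: a.
by rewrite b// totalS.
Qed.

Lemma level_le k : level k <= level k.+1.
Proof.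
rewrite levelS; case: ifP => // _.
by rewrite totalS lerDl ltW// filling_gt0.
Qed.

Lemma level_homo : {homo level : k l / (k <= l)%N >-> k <= l}.
Proof. exact: (homo_leq (@lexx _ _) (@le_trans _ _) level_le). Qed.

Lemma level_ge0 k : 0 <= level k.
Proof. by rewrite -level0; exact: level_homo. Qed.

Lemma cycle_start_ge e : 2 ^+ e - 1 <= cycle_start e.
Proof.
elim: e => [|e IH]; first by rewrite /cycle_start big_ord0 expr0 subrr.
rewrite /cycle_start big_ord_recr /= -/(cycle_start e) exprS.
by have := big_size_gt0 e; lra.
Qed.

Lemma cycle_start_le e : cycle_start e <= 2 * 2 ^+ e.
Proof.
elim: e => [|e IH]; first by rewrite /cycle_start big_ord0 expr0 mulr1.
rewrite /cycle_start big_ord_recr /= -/(cycle_start e) exprS.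
by have := big_size_le e; lra.
Qed.

Lemma cycle_le_level k : 2 ^+ cycle k <= level k + 1.
Proof.
have := cycle_start_ge (cycle k); rewrite /level.
have : (0 : R) <= (position k).-1%:R by rewrite ler0n.
have : (0 : R) < 2 ^+ cycle k by rewrite exprn_gt0.
by case: ifP => _; lra.
Qed.

Lemma filling_le k : filling k <= level k + 1.
Proof.
rewrite (le_trans _ (cycle_le_level k))// /filling; case: ifP => _.
  by rewrite exprn_ege1// ler1n.
exact: big_size_le.
Qed.

(** Cycle [e] has only as many 0-size orders as unit orders, so the number of orders stays linear in
    the total amount ordered. This bounds the fixed costs and shows that finitely many orders are
    placed in bounded time. *)
Lemma index_le_level k : k.+1%:R <= 4 * (level k + 1).
Proof.
have h : (cycle k < 2 ^ cycle k)%N by rewrite ltn_expl.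
have := cycle_position k; have := position_le k; rewrite expnS => pl cp.
have := cycle_start_ge (cycle k); rewrite /level -natrX.
case: ifP => h1 cs.
  have : (k.+1 <= 4 * 2 ^ cycle k)%N by lia.
  rewrite -(ler_nat R) natrM.
  have : (0 : R) <= (position k).-1%:R by rewrite ler0n.
  by lra.
have : (k.+1 <= 8 * 2 ^ cycle k)%N by lia.
by rewrite -(ler_nat R) natrM; lra.
Qed.

End Levels.

(** * First passage of u - g u for a continuous path g *)

Section HittingTimes.
Context {R : realType}.
Variable g : R -> R.
Hypothesis g0 : g 0 = 0.
Hypothesis gc : {within [set t : R | 0 <= t], continuous g}.

Definition reached (a t : R) := exists u, [/\ 0 <= u, u <= t & u - g u = a].

Lemma reached_homo a s t : s <= t -> reached a s -> reached a t.
Proof. by move=> st [u [u0 us e]]; exists u; rewrite (le_trans us). Qed.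

Lemma reached_IVT a t : 0 <= t -> 0 <= a -> a <= t - g t -> reached a t.
Proof.
move=> t0 a0 at_.
have [||u] := @IVT R (fun u => u - g u) 0 t a t0.
- apply: (@continuous_subspaceW _ _ _ [set t : R | 0 <= t]).
    by move=> x /=; rewrite in_itv /= => /andP[].
  by apply: within_continuousB; [apply: continuous_subspaceT => x; exact: cvg_id|exact: gc].
- rewrite g0 subr0; apply/andP; split; first by rewrite ge_min a0.
  by rewrite le_max at_ orbT.
by rewrite in_itv /= => /andP[u0 ut] e; exists u.
Qed.

Lemma reached_lower a b t : 0 <= a -> a <= b -> reached b t -> reached a t.
Proof.
move=> a0 ab [u [u0 ut ub]]; apply: (reached_homo ut).
by apply: reached_IVT => //; rewrite ub.
Qed.

(** Continuity of [g] is known on the half-line only. Freezing the path at [g 0] for negative times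
    gives a path continuous on the whole line, to which neighbourhood arguments and chaining
    apply. *)
Lemma extended_path_continuous : continuous (fun u : R => g (Order.max 0 u)).
Proof.
move=> x; have mx0 : 0 <= Order.max 0 x by rewrite le_max lexx.
have /subspace_continuousP/(_ _ mx0) h := gc.
apply: (@cvg_comp _ _ _ (fun u : R => Order.max 0 u) g _ _ _ _ h) => S hS.
have mc : {for x, continuous (fun u : R => Order.max 0 u)}.
  by apply: (@continuous_max _ _ (fun=> 0) id); [exact: cvg_cst|exact: cvg_id].
have hS' : nbhs (Order.max 0 x) (fun y => 0 <= y -> S y) by [].
have {}hS' : nbhs x (fun z => 0 <= Order.max 0 z -> S (Order.max 0 z)).
  exact: mc hS'.
apply: (@filterS _ (nbhs x) _ _ _ _ hS') => z hz; apply: hz.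
by rewrite le_max lexx.
Qed.

Definition first_hit (a : R) : \bar R :=
  ereal_inf [set u%:E | u in [set u : R | 0 <= u /\ u - g u = a]].

Lemma first_hit_ge0 a : (0 <= first_hit a)%E.
Proof. by apply: le_ereal_inf_tmp => _ [u [u0 _] <-]; rewrite lee_fin. Qed.

(** The infimum is attained, by continuity, so a comparison of extended reals amounts to the
    existence of a hitting time up to [t]. *)
Lemma first_hit_le a t : (first_hit a <= t%:E)%E <-> reached a t.
Proof.
split; last first.
  move=> [u [u0 ut ua]]; apply: (@le_trans _ _ u%:E); last by rewrite lee_fin.
  by apply: ereal_inf_lbound; exists u.
move=> ht.
set H := [set u : R | 0 <= u /\ u - g u = a].
have [H0|/set0P H0] := eqVneq H set0.
  by move: ht; rewrite /first_hit -/H H0 image_set0 ereal_inf0 leNgt ltry.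
have Hlb : has_lbound H by exists 0 => u [].
have Hinf : has_inf H by split.
have infle : inf H <= t.
  by move: ht; rewrite /first_hit -/H ereal_inf_EFin// lee_fin.
have inf0 : 0 <= inf H by apply: lb_le_inf => // u [].
exists (inf H); split => //.
(* If u - g u differed from [a] at the infimum, it would do so on a neighbourhood, which contains
   hitting times. *)
apply/eqP; apply: contrapT => /negP ne.
pose F u := u - g (Order.max 0 u) - a.
have Fc : continuous F.
  move=> x; apply: cvgB; last exact: cvg_cst.
  by apply: cvgB; [exact: cvg_id|exact: extended_path_continuous].
have Fn0 : F (inf H) != 0 by rewrite /F max_r// subr_eq0.
have : \forall u \near inf H, F u != 0.
  apply: (Fc (inf H) [set x | x != 0]); apply: open_nbhs_nbhs; split => //.
move=> /nbhs_ballP[e /= e0 he].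
have [u Hu ue] := inf_adherent e0 Hinf.
have iu : inf H <= u by apply: ge_inf.
have /eqP[] : F u != 0.
  by apply: he; rewrite /ball /= distrC ger0_norm ?subr_ge0// ltrBlDl.
by case: Hu => u0 ua; rewrite /F max_r// ua subrr.
Qed.

End HittingTimes.

(** * The policy and the inventory along one path *)

Section Policy.
Context {R : realType} {T : Type}.
Variables (W : R -> T -> R) (w : T).
Hypothesis W0 : W 0 w = 0.
Hypothesis Wc : {within [set t : R | 0 <= t], continuous (W ^~ w)}.
Local Notation g := (W ^~ w).
Local Notation path := (policy (inventory_without_orders W w)).

(** After order [k] the path is [total k.+1] - Z; unless order [k.+1] is simultaneous, it vanishes
    exactly where Z equals [level k.+1]. By the intermediate value theorem Z has reached [level k]
    by any such time, so restricting the infimum to times after order [k] changes nothing. *)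
Lemma policy_spec k : (path k).1 = first_hit g (level k) /\
  forall t, ((path k).1 <= t%:E)%E -> (path k).2 t = g t - t + total k.+1.
Proof.
elim: k => [|k [IH1 IH2]].
  have h0 : first_hit g 0 = 0%E.
    apply/eqP; rewrite eq_le first_hit_ge0 andbT.
    by apply/first_hit_le => //; exists 0; rewrite W0 subr0.
  split; first by rewrite level0 h0.
  move=> t t0; rewrite /= /apply_order /= t0 /total big_ord_recr big_ord0 /=.
  by rewrite add0r.
have -> : path k.+1 = ((if simultaneous_order k.+1 then (path k).1
    else hitting_time_after (path k).1 (path k).2),
    apply_order (path k).2 (if simultaneous_order k.+1 then (path k).1
    else hitting_time_after (path k).1 (path k).2) (order_size k.+1)).
  by rewrite {1}/policy -/policy; case: (path k).
set tau := (X in (X, _)).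
have tauE : tau = first_hit g (level k.+1).
  rewrite /tau levelS; case: ifP => // _.
  rewrite /hitting_time_after /first_hit; congr ereal_inf.
  congr image; apply/seteqP; split => t /= [].
    move=> ht; rewrite IH2// => e.
    have t0 : 0 <= t.
      by rewrite -lee_fin (le_trans _ ht)// IH1 first_hit_ge0.
    by split => //; move: e; lra.
  move=> t0 e; have ht : ((path k).1 <= t%:E)%E.
    rewrite IH1; apply/first_hit_le => //; apply: reached_IVT => //.
      exact: level_ge0.
    by rewrite e totalS lerDl ltW// filling_gt0.
  by split => //; rewrite IH2//; lra.
split => //= t ht; rewrite /apply_order ht.
rewrite [in RHS]/total big_ord_recr /= -/(total k.+1) addrA IH2//.
rewrite (le_trans _ ht)// tauE IH1; apply: le_ereal_inf_tmp => _ [u [u0 ue] <-].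
apply/first_hit_le => //; apply: reached_IVT => //; first exact: level_ge0.
by rewrite ue level_le.
Qed.

Lemma order_time_le k t : (order_time W k w <= t%:E)%E <-> reached g (level k) t.
Proof. by rewrite /order_time /order_time_path (policy_spec k).1; exact: first_hit_le. Qed.

Lemma order_levelsE k t : (order_time W k w <= t%:E)%E ->
  order_levels W k w = (total k - level k, total k.+1 - level k).
Proof.
move=> ht.
have tk : (path k).1 = (fine (path k).1)%:E.
  rewrite fineK// ge0_fin_numE; first by rewrite (le_lt_trans ht)// ltry.
  by rewrite (policy_spec k).1 first_hit_ge0.
rewrite /order_levels /order_levels_path /order_time_path.
move: tk; move: (fine _) => t' tk.
have [u [u0 ut ul]] : reached g (level k) t'.
  by apply/order_time_le; rewrite /order_time /order_time_path tk.
(* The level is attained at some [u] no later than the order time [t']; being a first hitting time,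
   [t'] is at most [u]. *)
have eu : u = t'.
  apply/eqP; rewrite eq_le ut /= -lee_fin -tk.
  by apply/order_time_le; exists u.
rewrite eu in u0 ul.
have -> : (path k).2 t' = total k.+1 - level k.
  by rewrite (policy_spec k).2 ?tk// -ul; ring.
apply: (@f_equal2 _ _ _ pair _ _ _ _ _ erefl).
case: k tk ut eu ul ht => [|k] tk ut eu ul ht.
  by rewrite /total big_ord0 /inventory_without_orders -ul; ring.
rewrite (policy_spec k).2 -?ul; first by ring.
apply/order_time_le; apply: (@reached_lower _ _ W0 Wc _ (level k.+1)).
- exact: level_ge0.
- exact: level_le.
- by exists t'.
Qed.

Section Horizon.
Variables (t ws : R).
Hypothesis t_ge0 : 0 <= t.
Hypothesis g_le : forall u : R, 0 <= u -> u <= t -> `|g u| <= ws.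

Lemma reached_le a : reached g a t -> a <= t + ws.
Proof.
move=> [u [u0 ut <-]]; have := g_le u0 ut; rewrite ler_norml => /andP[h _].
by lra.
Qed.

(** Levels are nondecreasing, so the orders placed by [t] form an initial segment. It is finite
    because Z stays below [t + ws] while [level] grows at least linearly in the index. *)
Lemma last_order : exists N, forall k,
  (order_time W k w <= t%:E)%E <-> (k <= N)%N.
Proof.
pose p k := `[< (order_time W k w <= t%:E)%E >].
have ex : exists k, p k.
  exists 0%N; apply/asboolP/order_time_le; rewrite level0.
  by exists 0; rewrite W0 subr0.
have bd k : p k -> (k <= Num.truncn (4 * (t + ws + 1)))%N.
  move=> /asboolP/order_time_le /reached_le h.
  have := index_le_level (R:=R) k => h1.
  have ws0 : 0 <= ws by apply: le_trans (g_le (lexx 0) t_ge0).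
  have : k%:R <= 4 * (t + ws + 1).
    by rewrite (le_trans (_ : _ <= k.+1%:R)) ?ler_nat//; lra.
  by move=> h2; rewrite truncn_ge_nat// mulr_ge0// !addr_ge0.
case: (ex_maxnP ex bd) => N /asboolP/order_time_le pN maxN; exists N => k; split.
  by move=> h; apply: maxN; exact/asboolP.
move=> kN; apply/order_time_le.
by apply: (reached_lower W0 Wc (level_ge0 k) _ pN); exact: level_homo.
Qed.

Lemma order_sum (f : nat -> R) : (forall k, 0 <= f k) ->
  exists N, [/\ reached g (level N) t, ~ reached g (level N.+1) t &
  (\sum_(0 <= k <oo) (if order_time W k w <= t%:E then (f k)%:E else 0) =
   (\sum_(k < N.+1) f k)%:E)%E].
Proof.
move=> f0; have [N hN] := last_order; exists N; split.
- by apply/order_time_le/hN.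
- by move/order_time_le/hN; rewrite ltnn.
rewrite (nneseries_split 0%N N.+1); last by move=> k _; case: ifP; rewrite ?lee_fin.
rewrite eseries0 ?adde0; last first.
  move=> k; rewrite add0n => Nk _; case: ifPn => // /hN.
  by rewrite leqNgt Nk.
rewrite add0n big_mkord -sumEFin; apply: eq_bigr => k _.
by case: ifPn => // /negP []; apply/hN; rewrite -ltnS.
Qed.

Lemma inventoryE : exists N, [/\ reached g (level N) t,
  ~ reached g (level N.+1) t & inventory W t w = g t - t + total N.+1].
Proof.
have [N [h1 h2 h3]] := order_sum (@order_size_ge0 R).
by exists N; split => //; rewrite /inventory h3.
Qed.

Lemma ordering_cost_le k1 : 0 <= k1 ->
  (\sum_(0 <= k <oo) (if order_time W k w <= t%:E
     then (c1 k1 (order_levels W k w))%:E else 0) <=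
   ((4 * k1 + 2) * (t + ws + 1))%:E)%E.
Proof.
move=> k10.
have -> : (\sum_(0 <= k <oo) (if order_time W k w <= t%:E
     then (c1 k1 (order_levels W k w))%:E else 0) =
   \sum_(0 <= k <oo) (if order_time W k w <= t%:E
     then (k1 + order_size k)%:E else 0))%E.
  apply: eq_eseriesr => k _; case: ifPn => // h.
  rewrite (order_levelsE h) /c1 /=; congr (_%:E).
  by rewrite [total k.+1]/total big_ord_recr /= -/(total k); ring.
have f0 k : 0 <= k1 + order_size k by rewrite addr_ge0// order_size_ge0.
have [N [/reached_le lN _ ->]] := order_sum f0.
rewrite lee_fin big_split /= sumr_const card_ord -(mulr_natr k1) -/(total N.+1) totalS.
have h1 := filling_le (R:=R) N.
have h2 := ler_wpM2l k10 (index_le_level (R:=R) N).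
have h3 : k1 * (4 * (level N + 1)) <= k1 * (4 * (t + ws + 1)).
  by apply: ler_wpM2l => //; lra.
have -> : (4 * k1 + 2) * (t + ws + 1) = k1 * (4 * (t + ws + 1)) + 2 * (t + ws + 1).
  by ring.
by apply: lerD; [exact: le_trans h2 h3|lra].
Qed.

End Horizon.

Definition big_level e : R := cycle_start e + 2 ^+ e.

(** If [N] is the last order placed by [t] and Z takes its level at [u], then X t = [filling N] + Z
    u - Z t. When this filling is the large size of cycle [e], Z has reached [big_level e] by [t],
    but Z t is below [big_level e + big_size e]. As Z s differs from s by at most [ws], this
    confines [t] to an interval. *)
Lemma inventory_le (h ws : R) : 0 <= h ->
  (forall u : R, 0 <= u -> u <= h -> `|g u| <= ws) ->
  exists E, 2 ^+ E <= 2 * (h + ws + 1) /\ forall t : R, 0 <= t -> t <= h ->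
  exists u : R, [/\ 0 <= u, u <= t & `|inventory W t w| <= 1 +
    \sum_(e < E) big_size e *
      \1_(`[big_level e - ws, big_level e + big_size e + ws]%classic) t +
    (g t - g u - (t - u))].
Proof.
move=> h0 gws.
have ws0 : 0 <= ws by apply: le_trans (gws 0 (lexx 0) h0).
have y1 : (0 < Num.truncn (h + ws + 1))%N.
  by rewrite truncn_gt0; lra.
(* A cycle [e] that has started by time [h] satisfies [2 ^ e <= h + ws + 1], so [E] exceeds every
   such [e]. *)
exists (trunc_log 2 (Num.truncn (h + ws + 1))).+1; split.
  rewrite exprS ler_pM2l//.
  apply: (@le_trans _ _ (Num.truncn (h + ws + 1))%:R); last first.
    by rewrite truncn_le !addr_ge0.
  by rewrite -natrX ler_nat trunc_logP.
move=> t t0 th.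
have gt u : 0 <= u -> u <= t -> `|g u| <= ws.
  by move=> u0 ut; apply: gws => //; exact: le_trans th.
have [N [rN rN1 XE]] := inventoryE t0 gt.
have lN := reached_le gt rN.
have [u [u0 ut uN]] := rN.
exists u; split => //.
(* Otherwise order [N.+1] would have been placed by [t]. This also makes X t positive. *)
have tN : t - g t < total N.+1.
  rewrite ltNge; apply/negP => tN; apply: rN1; rewrite levelS; case: ifP => // _.
  by apply: reached_IVT => //; rewrite totalS addr_ge0 ?level_ge0// ltW// filling_gt0.
rewrite XE ger0_norm; last by lra.
have s0 (A : set R) e : 0 <= (big_size e : R) * \1_A t.
  by rewrite mulr_ge0// ltW// big_size_gt0.
suff : filling N <= 1 + \sum_(e < (trunc_log 2 (Num.truncn (h + ws + 1))).+1)
   (big_size e : R) * \1_(`[big_level e - ws, big_level e + big_size e + ws]%classic) t.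
  by move: tN; rewrite totalS; lra.
move: tN lN; rewrite totalS /filling /level.
case: ifPn => [_ _ _|_ tN lN]; first by rewrite lerDl sumr_ge0.
have cE : (cycle N < (trunc_log 2 (Num.truncn (h + ws + 1))).+1)%N.
  rewrite ltnS trunc_log_max// truncn_ge_nat; last by lra.
  by have := cycle_start_ge (R:=R) (cycle N); rewrite natrX; lra.
rewrite (bigD1 (Ordinal cE))//= indicE mem_set ?mulr1.
  by rewrite addrCA lerDl addr_ge0// sumr_ge0.
have /ler_normlP[_ gtt] := gt t t0 (lexx t).
by rewrite /= in_itv /= /big_level; apply/andP; split; lra.
Qed.

End Policy.

(** * Chaining over dyadic grids with fourth powers *)

Section Chaining.
Context {R : realType}.
Implicit Types (g : R -> R) (r L l u v a x : R).

Definition dyadic_increment g r L m k : R :=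
  g (r + L * k.+1%:R / 2 ^+ m) - g (r + L * k%:R / 2 ^+ m).

(* The weight [125/64 = (5/4) ^ 3] makes both this sum (in expectation) and
   the sum of [(4/5) ^ m] over the scales [m] geometric. *)
Definition chaining_term g r L m : R :=
  (125 / 64) ^+ m * \sum_(k < 2 ^ m) dyadic_increment g r L m k ^+ 4.

Lemma exp4_ge0 (x : R) : 0 <= x ^+ 4.
Proof. by rewrite (exprM x 2 2) sqr_ge0. Qed.

Lemma chaining_term_ge0 g r L m : 0 <= chaining_term g r L m.
Proof.
apply: mulr_ge0; first by apply: exprn_ge0; lra.
by apply: sumr_ge0 => k _; exact: exp4_ge0.
Qed.

(** If |x| > a, then |x| = x^4 / |x|^3 < x^4 / a^3. The bound is linear in the fourth power, so
    expectations can be taken directly. *)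
Lemma norm_le_exp4 (a x : R) : 0 < a -> `|x| <= a + x ^+ 4 / a ^+ 3.
Proof.
move=> a0; have [xa|ax] := leP `|x| a.
  by rewrite (le_trans xa)// lerDl divr_ge0// ?exp4_ge0// exprn_ge0// ltW.
rewrite -[leLHS]add0r; apply: lerD; first exact: ltW.
rewrite ler_pdivlMr ?exprn_gt0//.
have -> : x ^+ 4 = `|x| ^+ 4 by rewrite (exprM `|x| 2 2) real_normK ?num_real// -exprM.
by rewrite [leRHS]exprS ler_wpM2l// lerXn2r// ?nnegrE ltW.
Qed.

(** This is [norm_le_exp4] at a = l (4/5)^m: the inverse cube of (4/5)^m is the weight of
    [chaining_term], and one fourth power is at most the sum over the whole scale. *)
Lemma dyadic_increment_le g r L m k l : 0 < l -> (k < 2 ^ m)%N ->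
  `|dyadic_increment g r L m k| <= l * (4 / 5) ^+ m + chaining_term g r L m / l ^+ 3.
Proof.
move=> l0 km; have q0 : 0 < l * (4 / 5 : R) ^+ m by rewrite mulr_gt0// exprn_gt0//; lra.
rewrite (le_trans (norm_le_exp4 _ q0))// lerD2l exprMn invfM mulrA.
rewrite [X in X <= _]mulrAC; apply: ler_wpM2r.
  by rewrite invr_ge0 exprn_ge0// ltW.
have -> : ((4 / 5 : R) ^+ m ^+ 3)^-1 = (125 / 64) ^+ m.
  by rewrite -exprM mulnC exprM -exprVn; congr (_ ^+ _); field.
rewrite mulrC /chaining_term; apply: ler_wpM2l; first by apply: exprn_ge0; lra.
rewrite (bigD1 (Ordinal km))//= lerDl sumr_ge0// => j _; exact: exp4_ge0.
Qed.

(** An even grid point of scale n + 1 lies on the grid of scale n, and an odd one is a single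
    increment away from the even point to its left. *)
Lemma chaining_dyadic g r L l n j : 0 < l -> (j <= 2 ^ n)%N ->
  `|g (r + L * j%:R / 2 ^+ n) - g r| <=
  \sum_(m < n.+1) (l * (4 / 5) ^+ m + chaining_term g r L m / l ^+ 3).
Proof.
move=> l0; elim: n j => [|n IH] j jn.
  rewrite big_ord1; case: j jn => [|[|//]] _; last first.
    have := @dyadic_increment_le g r L 0 0 l l0 (ltn0Sn 0).
    by rewrite /dyadic_increment !mulr0 mul0r addr0.
  rewrite mulr0 mul0r addr0 subrr normr0 addr_ge0//.
    by rewrite mulr_ge0// ltW.
  by rewrite divr_ge0// ?chaining_term_ge0// exprn_ge0// ltW.
rewrite big_ord_recr /=.
have half : L * (j./2.*2)%:R / 2 ^+ n.+1 = L * j./2%:R / 2 ^+ n.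
  by rewrite -muln2 natrM exprS; field; rewrite expf_neq0.
have j2 : (j./2 <= 2 ^ n)%N by move: jn; rewrite expnS; lia.
have [oj|ej] := boolP (odd j); last first.
  rewrite -(odd_double_half j) (negbTE ej) add0n half.
  rewrite (le_trans (IH _ j2))// lerDl addr_ge0//.
    by rewrite mulr_ge0// ?exprn_ge0 ?ltW//; lra.
  by rewrite divr_ge0// ?chaining_term_ge0// exprn_ge0// ltW.
rewrite -(odd_double_half j) oj add1n.
have jn' : (j./2.*2 < 2 ^ n.+1)%N by lia.
have := dyadic_increment_le g r L l0 jn'; rewrite /dyadic_increment half.
have := IH _ j2; set a := g _; set b := g _; set c := g _ => h1 h2.
have -> : c - b = (a - b) + (c - a) by ring.
by rewrite (le_trans (ler_normD _ _))// lerD.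
Qed.

(** Dyadic points are dense and 5 is the sum of the powers of 4/5. The scale [l] is left free: it is
    matched with the drift in one application and with |g u| in another. *)
Lemma chaining g r L l v u : continuous g -> 0 < l -> 0 < L ->
  (forall n, \sum_(m < n) chaining_term g r L m <= v) ->
  r <= u -> u <= r + L -> `|g u - g r| <= 5 * l + v / l ^+ 3.
Proof.
move=> gc l0 L0 hv ru uL.
have bd n j : (j <= 2 ^ n)%N ->
    `|g (r + L * j%:R / 2 ^+ n) - g r| <= 5 * l + v / l ^+ 3.
  move=> jn; rewrite (le_trans (chaining_dyadic g r L l0 jn))// big_split /=.
  rewrite -mulr_suml; apply: lerD; last first.
    by apply: ler_wpM2r; [rewrite invr_ge0 exprn_ge0// ltW|exact: hv].
  rewrite -mulr_sumr mulrC; apply: ler_wpM2r; first exact: ltW.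
  have -> : \sum_(i < n.+1) (4 / 5 : R) ^+ i = 5 * (1 - (4 / 5) ^+ n.+1).
    have := subrX1 (4 / 5 : R) n.+1; move: (\sum_(i < _) _) => s; lra.
  have : 0 <= (4 / 5 : R) ^+ n.+1 by rewrite exprn_ge0//; lra.
  by lra.
apply/ler_addgt0Pl => e e0.
have /cvgrPdist_lt/(_ e e0)/nbhs_ballP[d /= d0 hd] := gc u.
pose n := Num.truncn (L / d).
have nd : L / 2 ^+ n < d.
  rewrite ltr_pdivrMr ?exprn_gt0// mulrC -ltr_pdivrMr//.
  apply: (@lt_le_trans _ _ n.+1%:R); first exact: truncnS_gt.
  by rewrite -natrX ler_nat ltn_expl.
(* The abscissa of [u] in units of the grid; its integer part [j] gives the grid point to the left
   of [u], within L / 2^n < d. *)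
pose x := 2 ^+ n * ((u - r) / L).
have x0 : 0 <= x by rewrite mulr_ge0// ?exprn_ge0// divr_ge0// ?subr_ge0// ltW.
have x1 : x <= 2 ^+ n.
  by rewrite ler_piMr ?exprn_ge0// ler_pdivrMr// mul1r lerBlDl.
pose j := Num.truncn x.
have /andP[jx xj] := truncn_itv x0.
have jn : (j <= 2 ^ n)%N by rewrite -(ler_nat R) natrX (le_trans jx).
have hj := bd n j jn.
have : `|g u - g (r + L * j%:R / 2 ^+ n)| < e.
  apply: hd; rewrite /ball /=.
  have -> : u - (r + L * j%:R / 2 ^+ n) = (x - j%:R) * (L / 2 ^+ n).
    rewrite /x; field; rewrite expf_neq0//=; first by rewrite gt_eqF.
  rewrite normrM ger0_norm ?subr_ge0// ger0_norm; last first.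
    by rewrite divr_ge0// ?exprn_ge0// ltW.
  rewrite (le_lt_trans _ nd)// ler_piMl ?divr_ge0 ?exprn_ge0// ?ltW//.
  by rewrite -natr1 in xj; rewrite -/j in xj; lra.
move=> h; have -> : g u - g r = (g u - g (r + L * j%:R / 2 ^+ n)) +
  (g (r + L * j%:R / 2 ^+ n) - g r) by ring.
apply: le_trans (ler_normD _ _) _; apply: lerD => //; exact: ltW.
Qed.

End Chaining.

(** * Bounds on series of nonnegative extended reals *)

Lemma nneseries_le_bound {R : realType} (u : nat -> \bar R) (c : \bar R) :
  (forall n, 0 <= u n)%E -> (forall n, \sum_(0 <= i < n) u i <= c)%E ->
  (\sum_(0 <= i <oo) u i <= c)%E.
Proof.
move=> u0 uc; apply: lime_le; first by apply: is_cvg_nneseries.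
by near=> n; exact: uc.
Unshelve. all: by end_near. Qed.

Lemma nneseries_term_le {R : realType} (u : nat -> \bar R) k :
  (forall n, 0 <= u n)%E -> (u k <= \sum_(0 <= i <oo) u i)%E.
Proof.
move=> u0; apply: le_trans (nneseries_lim_ge k.+1 _) => //.
by rewrite big_nat_recr//= leeDr// sume_ge0.
Qed.

Lemma nneseries_geometric_le {R : realType} (a z : R) : 0 <= a -> 0 <= z -> z < 1 ->
  (\sum_(0 <= j <oo) (a * z ^+ j)%:E <= (a / (1 - z))%:E)%E.
Proof.
move=> a0 z0 z1; apply: nneseries_le_bound => n.
  by rewrite lee_fin mulr_ge0// exprn_ge0.
rewrite sumEFin lee_fin -mulr_sumr; apply: ler_wpM2l => //.
rewrite big_mkord -[leRHS]mul1r ler_pdivlMr ?subr_gt0//.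
have := subrX1 z n; have : 0 <= z ^+ n by rewrite exprn_ge0.
by move: (\sum_(_ < _) _) => q; lra.
Qed.

(** * Gaussian tails and fourth moments *)

Section NormalTail.
Context {R : realType}.
Implicit Types (a s x y : R).

Lemma expR_ge_cube y : 0 <= y -> y ^+ 3 / 27 <= expR y.
Proof.
move=> y0; have -> : expR y = expR (y / 3) ^+ 3.
  by rewrite -expRM_natl; congr expR; field.
have -> : y ^+ 3 / 27 = (y / 3) ^+ 3 by field.
rewrite lerXn2r// ?nnegrE ?divr_ge0// ?expR_ge0//.
by apply: le_trans (expR_ge1Dx _); rewrite lerDr.
Qed.

(** The ratio of the two densities is 2 exp(-3 x^2 / (8 s^2)), here at most 2 exp(-3 a^2 / 8), and
    [expR_ge_cube] applies with (3 a^2 / 8)^3 / 27 = a^6 / 512. Since the wider law has mass 1, a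
    tail bound follows without computing a Gaussian moment. *)
Lemma normal_pdf_le_double s a x : 0 < s -> 0 < a -> a * s <= `|x| ->
  normal_pdf 0 s x <= 1024 / a ^+ 6 * normal_pdf 0 (2 * s) x.
Proof.
move=> s0 a0 ax.
rewrite !normal_pdfE; [|by rewrite gt_eqF// mulr_gt0|by rewrite gt_eqF].
have -> : normal_peak s = 2 * normal_peak (2 * s) :> R.
  rewrite /normal_peak.
  have -> : (2 * s) ^+ 2 * pi *+ 2 = 2 ^+ 2 * (s ^+ 2 * pi *+ 2) by ring.
  rewrite sqrtrM ?sqrtr_sqr ?ger0_norm// invfM mulrA divff ?mul1r//.
set y := 3 * x ^+ 2 / (8 * s ^+ 2).
have -> : normal_fun 0 s x = normal_fun 0 (2 * s) x * expR (- y).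
  rewrite /normal_fun -expRD; congr expR; rewrite /y; field.
  by rewrite gt_eqF.
have ya : 3 * a ^+ 2 / 8 <= y.
  rewrite /y -(real_normK (num_real x)) ler_pdivlMr ?mulr_gt0// ?exprn_gt0//.
  have := lerXn2r 2 _ _ ax; rewrite !nnegrE => /(_ (mulr_ge0 (ltW a0) (ltW s0)) (normr_ge0 _)).
  by rewrite exprMn; lra.
have y3 : expR (- y) <= 512 / a ^+ 6.
  have z0 : 0 < 3 * a ^+ 2 / 8 by rewrite divr_gt0// mulr_gt0// exprn_gt0.
  have : expR (- y) <= (expR (3 * a ^+ 2 / 8))^-1 by rewrite -expRN ler_expR lerN2.
  move=> h; apply: (le_trans h).
  have -> : 512 / a ^+ 6 = (a ^+ 6 / 512)^-1 by rewrite invf_div.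
  have c6 : 0 < a ^+ 6 / 512 by apply: divr_gt0; [exact: exprn_gt0|rewrite ltr0n].
  rewrite lef_pV2; [|by rewrite posrE expR_gt0|by rewrite posrE].
  apply: le_trans (expR_ge_cube (ltW z0)).
  have -> : (3 * a ^+ 2 / 8) ^+ 3 / 27 = a ^+ 6 / 512 by field.
  exact: lexx.
have n0 : 0 <= normal_peak (2 * s) * normal_fun 0 (2 * s) x.
  by rewrite mulr_ge0// ?normal_peak_ge0// normal_fun_ge0.
have -> : 1024 / a ^+ 6 = 2 * (512 / a ^+ 6) by field; rewrite gt_eqF.
move: (ler_wpM2l n0 y3); lra.
Qed.

Lemma normal_prob_tail s a : 0 < s -> 0 < a ->
  (normal_prob 0 s [set x : R | (a * s <= `|x|)%R] <= (1024 / a ^+ 6)%:E)%E.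
Proof.
move=> s0 a0; set A := [set _ | _].
have mA : measurable A.
  rewrite -[A]setTI; apply: measurable_fun_le => //.
have c0 : 0 <= 1024 / a ^+ 6.
  by apply: divr_ge0; [rewrite ler0n|rewrite exprn_ge0// ltW].
have le x : A x -> normal_pdf 0 s x <= 1024 / a ^+ 6 * normal_pdf 0 (2 * s) x.
  exact: normal_pdf_le_double.
move: (1024 / a ^+ 6) c0 le => c c0 le.
apply: (@le_trans _ _ (c%:E * normal_prob 0 (2 * s) A)%E); last first.
  have := lee_wpmul2l (_ : (0 <= c%:E)%E) (probability_le1 (normal_prob 0 (2 * s)) mA).
  by rewrite mule1; apply; rewrite lee_fin.
rewrite /normal_prob -ge0_integralZl_EFin//; first last.
- by apply/measurable_EFinP/measurable_funTS; exact: measurable_normal_pdf.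
- by move=> x _; rewrite lee_fin normal_pdf_ge0.
apply: ge0_le_integral => //.
- by move=> x _; rewrite lee_fin normal_pdf_ge0.
- by apply/measurable_EFinP/measurable_funTS; exact: measurable_normal_pdf.
- apply: measurable_funeM.
  by apply/measurable_EFinP/measurable_funTS; exact: measurable_normal_pdf.
Qed.

End NormalTail.

Lemma integral_probability_cst {R : realType} d (T : measurableType d)
  (P : probability T R) (r : \bar R) : (\int[P]_w r = r)%E.
Proof.
have P1 : P setT = 1%E by exact: probability_setT.
have rP : (r * P setT = r)%E by rewrite P1 mule1.
exact: etrans (integral_cst P measurableT r) rP.
Qed.

Section FourthMoment.
Context {R : realType} d (T : measurableType d) (P : probability T R).
Local Open Scope ereal_scope.

(** Where |X| / s lies between 2^j and 2^(j+1), X^4 is at most s^4 16^(j+1). The tail bound makes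
    the expected layers decay like 16^j / 64^j, and 22 exceeds 16 * 4/3. *)
Lemma fourth_moment_le_tail (X : T -> R) (s C : R) : measurable_fun setT X ->
  (0 < s)%R -> (0 <= C)%R ->
  (forall a : R, (0 < a)%R -> P [set w | (a * s <= `|X w|)%R] <= (C / a ^+ 6)%:E) ->
  \int[P]_w ((X w) ^+ 4)%:E <= (s ^+ 4 * (1 + 22 * C))%:E.
Proof.
move=> mX s0 C0 tail.
pose A j := [set w | (2 ^+ j * s <= `|X w|)%R].
have mA j : measurable (A j).
  rewrite -[A j]setTI; apply: measurable_fun_le => //.
  exact: measurableT_comp.
pose f (j : nat) (w : T) := (s ^+ 4 * 16 ^+ j.+1)%:E * (\1_(A j) w)%:E.
have c0 j : (0 <= s ^+ 4 * 16 ^+ j.+1)%R by rewrite mulr_ge0// exprn_ge0// ltW.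
have f0 j w : 0 <= f j w by rewrite mule_ge0// lee_fin.
have mf j : measurable_fun setT (f j).
  by apply: measurable_funeM; apply/measurable_EFinP; exact: measurable_indic.
have dom w : ((X w) ^+ 4)%:E <= (s ^+ 4)%:E + \sum_(0 <= j <oo) f j w.
  have x4 : (X w ^+ 4 = `|X w| ^+ 4)%R.
    by rewrite (exprM `|X w| 2 2) real_normK ?num_real// -exprM.
  have [lt|ge] := ltP `|X w|%R s.
    apply: (@le_trans _ _ (s ^+ 4)%:E); last first.
      by rewrite leeDl// nneseries_ge0.
    by rewrite lee_fin x4 lerXn2r// ?nnegrE ?ltW.
  pose y := (`|X w| / s)%R.
  have y1 : (1 <= y)%R by rewrite ler_pdivlMr// mul1r.
  have t1 : (0 < Num.truncn y)%N by rewrite truncn_gt0.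
  have /andP[jl ju] := trunc_log_bounds (isT : (1 < 2)%N) t1.
  pose j := trunc_log 2 (Num.truncn y).
  have jy : (2 ^+ j <= y)%R.
    by rewrite -natrX (le_trans (_ : _ <= (Num.truncn y)%:R)%R) ?ler_nat// truncn_le (le_trans _ y1).
  have yj : (y <= 2 ^+ j.+1)%R.
    by apply: ltW; rewrite (lt_le_trans (truncnS_gt _))// -natrX ler_nat.
  apply: (@le_trans _ _ (f j w)); last first.
    rewrite (le_trans (_ : _ <= \sum_(0 <= j <oo) f j w))//; last first.
      by rewrite leeDr// lee_fin exprn_ge0// ltW.
    exact: (nneseries_term_le j (f0^~ w)).
  rewrite /f indicE mem_set ?mule1; last first.
    by rewrite /A /= -ler_pdivlMr.
  rewrite lee_fin x4.
  have -> : (`|X w| = s * y)%R by rewrite /y mulrC divfK// gt_eqF.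
  rewrite exprMn; apply: ler_wpM2l; first by rewrite exprn_ge0// ltW.
  rewrite (_ : 16 = 2 ^+ 4)%R; last by ring.
  rewrite -exprM mulnC exprM; apply: lerXn2r => //; rewrite nnegrE.
    by rewrite (le_trans _ y1).
  by rewrite exprn_ge0.
have m4 : measurable_fun setT (fun w => (X w ^+ 4)%:E).
  by apply/measurable_EFinP; exact: measurable_funX.
apply: (@le_trans _ _ (\int[P]_w ((s ^+ 4)%:E + \sum_(0 <= j <oo) f j w))).
  apply: ge0_le_integral => //.
  - by move=> w _; rewrite lee_fin exp4_ge0.
  - apply: emeasurable_funD => //.
    by apply: ge0_emeasurable_sum.
rewrite ge0_integralD//; first last.
- by apply: ge0_emeasurable_sum.
- by move=> w _; rewrite nneseries_ge0.
- by move=> w _; rewrite lee_fin exprn_ge0// ltW.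
rewrite integral_probability_cst integral_nneseries//.
have If j : \int[P]_w f j w <= (s ^+ 4 * (16 * C) * (1 / 4) ^+ j)%:E.
  rewrite /f ge0_integralZl_EFin//; last first.
    by apply/measurable_EFinP; exact: measurable_indic.
  rewrite integral_indic// setIT.
  have t0 : (0 < 2 ^+ j :> R)%R by rewrite exprn_gt0.
  have := lee_wpmul2l (_ : 0 <= (s ^+ 4 * 16 ^+ j.+1)%:E) (tail _ t0).
  rewrite lee_fin => /(_ (c0 j)) h; apply: (le_trans h).
  rewrite -EFinM lee_fin le_eqVlt; apply/orP; left; apply/eqP.
  have -> : ((2 ^+ j) ^+ 6 = 64 ^+ j :> R)%R.
    by rewrite -exprM mulnC exprM; congr (_ ^+ _)%R; ring.
  have -> : ((1 / 4) ^+ j = 16 ^+ j / 64 ^+ j :> R)%R.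
    by rewrite -exprVn -exprMn; congr (_ ^+ _)%R; field.
  by rewrite (exprS 16 j); ring.
apply: (@le_trans _ _ ((s ^+ 4)%:E +
    \sum_(0 <= j <oo) (s ^+ 4 * (16 * C) * (1 / 4) ^+ j)%:E)).
  apply: leeD2l; apply: lee_nneseries => [j _|j _]; last exact: If.
  by move=> _; apply: integral_ge0.
have : \sum_(0 <= j <oo) (s ^+ 4 * (16 * C) * (1 / 4) ^+ j)%:E <=
    (s ^+ 4 * (16 * C) / (1 - 1 / 4))%:E.
  apply: nneseries_geometric_le; [|lra|lra].
  by apply: mulr_ge0; [exact: exp4_ge0|rewrite mulr_ge0].
move=> h; apply: (le_trans (leeD2l _ h)); rewrite -EFinD lee_fin.
rewrite mulrDr mulr1; apply: lerD => //; rewrite -mulrA; apply: ler_wpM2l.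
  by rewrite exprn_ge0// ltW.
by rewrite (_ : (1 - 1 / 4)^-1 = 4 / 3 :> R)%R; [lra|field].
Qed.

End FourthMoment.

(** * Oscillation, supremum and drift bounds for one path *)

Section ChainingSum.
Context {R : realType}.
Implicit Types (g : R -> R) (r L l u v t : R).
Local Open Scope ereal_scope.

(** Extended real-valued, so that no path has to be excluded: upper bounds by an infinite sum hold
    trivially. *)
Definition chaining_sum g r L : \bar R :=
  \sum_(0 <= m <oo) (chaining_term g r L m)%:E.

Lemma chaining_sum_ge0 g r L : 0 <= chaining_sum g r L.
Proof. by apply: nneseries_ge0 => m _ _; rewrite lee_fin chaining_term_ge0. Qed.

Lemma chaining_sum_partial g r L v n : chaining_sum g r L = v%:E ->
  (\sum_(m < n) chaining_term g r L m <= v)%R.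
Proof.
move=> gv; rewrite -lee_fin -gv -sumEFin -(big_mkord xpredT (fun m => (chaining_term g r L m)%:E)).
by apply: nneseries_lim_ge => m _ _; rewrite lee_fin chaining_term_ge0.
Qed.

Lemma oscillation_le g r L l u t : continuous g -> (0 < l)%R -> (0 < L)%R ->
  (r <= u <= r + L)%R -> (r <= t <= r + L)%R ->
  `|g t - g u|%:E <= (10 * l)%:E + (2 / l ^+ 3)%:E * chaining_sum g r L.
Proof.
move=> gc l0 L0 /andP[ru uL] /andP[rt tL].
have l3 : (0 < 2 / l ^+ 3)%R by rewrite divr_gt0// exprn_gt0.
case E : (chaining_sum g r L) (chaining_sum_ge0 g r L) => [v||] // _; last first.
  by rewrite gt0_muley ?lte_fin// addey// leey.
have hv n := chaining_sum_partial n E.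
have h1 := chaining gc l0 L0 hv ru uL; have h2 := chaining gc l0 L0 hv rt tL.
rewrite -EFinM -EFinD lee_fin.
have -> : (g t - g u = (g t - g r) - (g u - g r))%R by ring.
apply: le_trans (ler_normB _ _) _.
apply: le_trans (lerD h2 h1) _; rewrite le_eqVlt; apply/orP; left; apply/eqP.
by field; rewrite gt_eqF.
Qed.

(** Chaining at scale l = |g u| / 10 bounds |g u| by half of itself plus 10^3 v / |g u|^3. *)
Lemma sup_pow4_le g h v u : continuous g -> g 0%R = 0%R -> (0 < h)%R ->
  chaining_sum g 0 h = v%:E -> (0 <= u)%R -> (u <= h)%R ->
  (`|g u| ^+ 4 <= 2 * 10 ^+ 3 * v)%R.
Proof.
move=> gc g0 h0 E u0 uh; have hv n := chaining_sum_partial n E.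
have v0 : (0 <= v)%R by have := chaining_sum_ge0 g 0 h; rewrite E lee_fin.
have [->|gu] := eqVneq (g u) 0%R.
  by rewrite normr0 expr0n /= !mulr_ge0// exprn_ge0.
set x := `|g u|%R; have x0 : (0 < x)%R by rewrite normr_gt0.
have l0 : (0 < x / 10)%R by rewrite divr_gt0.
have uh' : (u <= 0 + h)%R by rewrite add0r.
have := chaining gc l0 h0 hv u0 uh'; rewrite g0 subr0 -/x.
have -> : (5 * (x / 10) + v / (x / 10) ^+ 3 = x / 2 + 10 ^+ 3 * v / x ^+ 3)%R.
  by field; rewrite gt_eqF.
move=> hx; have : (x / 2 <= 10 ^+ 3 * v / x ^+ 3)%R by lra.
rewrite ler_pdivlMr ?exprn_gt0//.
have -> : (x / 2 * x ^+ 3 = x ^+ 4 / 2)%R by ring.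
by lra.
Qed.

(** The windows of length 2^k all end at n + 1, so that any u <= t with t in [n, n + 1] lie in one
    with 2^k / 2 <= 1 + (t - u). The leading 1 is the 1 of this inequality. *)
Definition drift_bound g (n : nat) : \bar R :=
  1 + \sum_(0 <= k <oo)
    (2 * 20 ^+ 3 / 8 ^+ k)%:E * chaining_sum g (n.+1%:R - 2 ^+ k) (2 ^+ k).

(* Over a window of length [2 ^ k] the drift [2 ^ k / 2] absorbs the main term
   of the oscillation bound taken at scale [l = 2 ^ k / 20]. *)
Lemma drift_bound_ge g n t u : continuous g -> (n%:R <= t <= n.+1%:R)%R ->
  (0 <= u <= t)%R -> (g t - g u - (t - u))%:E <= drift_bound g n.
Proof.
move=> gc /andP[nt tn] /andP[u0 ut].
have f0 k : 0 <= (2 * 20 ^+ 3 / 8 ^+ k)%:E * chaining_sum g (n.+1%:R - 2 ^+ k) (2 ^+ k).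
  by rewrite mule_ge0// ?chaining_sum_ge0// lee_fin divr_ge0// ?mulr_ge0// exprn_ge0.
have ex : exists k, (n.+1%:R - u <= 2 ^+ k)%R.
  exists n.+1; rewrite -natrX (le_trans (_ : _ <= n.+1%:R)%R)//; first by lra.
  by rewrite ler_nat ltnW// ltn_expl.
case: (ex_minnP ex) => k hk kmin.
have small : (2 ^+ k / 2 <= 1 + (t - u))%R.
  case: k hk kmin => [|k] hk kmin; first by rewrite expr0; lra.
  have : ~~ (n.+1%:R - u <= 2 ^+ k)%R.
    by apply/negP => /kmin; rewrite ltnn.
  by rewrite -ltNge exprS => h; lra.
have p0 : (0 < 2 ^+ k :> R)%R by rewrite exprn_gt0.
have l0 : (0 < 2 ^+ k / 20 :> R)%R by rewrite divr_gt0.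
have w1 : (n.+1%:R - 2 ^+ k <= u <= n.+1%:R - 2 ^+ k + 2 ^+ k)%R.
  by apply/andP; split; lra.
have w2 : (n.+1%:R - 2 ^+ k <= t <= n.+1%:R - 2 ^+ k + 2 ^+ k)%R.
  by apply/andP; split; lra.
have h := oscillation_le gc l0 p0 w1 w2.
have e1 : (10 * (2 ^+ k / 20) = 2 ^+ k / 2 :> R)%R by field.
have e2 : (2 / (2 ^+ k / 20) ^+ 3 = 2 * 20 ^+ 3 / 8 ^+ k :> R)%R.
  have -> : (8 ^+ k = (2 ^+ k) ^+ 3 :> R)%R.
    by rewrite -exprM mulnC exprM; congr (_ ^+ _)%R; ring.
  by field; rewrite gt_eqF.
rewrite e1 e2 in h.
apply: le_trans (leeD2l 1 (nneseries_term_le k f0)).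
move: h; set c := _ * chaining_sum _ _ _.
have c0 : 0 <= c by exact: f0.
case: c c0 => [c||] c0 // h; last by rewrite addey// leey.
move: h; rewrite -!EFinD !lee_fin => h.
have := ler_norm (g t - g u)%R; lra.
Qed.

End ChainingSum.

(** * Expectations of the chaining bounds *)

Section Moments.
Context {R : realType} d (T : measurableType d) (P : probability T R).
Variables (W : R -> T -> R) (K : R).
Hypothesis mW : forall t, measurable_fun setT (W t).
Hypothesis K_ge0 : 0 <= K.
Hypothesis W_moment : forall s t : R, s <= t ->
  (\int[P]_w ((W t w - W s w) ^+ 4)%:E <= (K * (t - s) ^+ 2)%:E)%E.
Local Open Scope ereal_scope.

Let path (w : T) : R -> R := fun t => W t w.

Lemma measurable_increment4 s t :
  measurable_fun setT (fun w => ((W t w - W s w) ^+ 4)%:E).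
Proof. by apply/measurable_EFinP/measurable_funX/measurable_funB. Qed.

Lemma measurable_chaining_term r L m :
  measurable_fun setT (fun w => (chaining_term (path w) r L m)%:E).
Proof.
apply/measurable_EFinP/measurable_funM => //.
apply: measurable_sum => k; apply: measurable_funX.
rewrite /dyadic_increment /path; exact: measurable_funB.
Qed.

Lemma measurable_chaining_sum r L :
  measurable_fun setT (fun w => chaining_sum (path w) r L).
Proof.
apply: ge0_emeasurable_sum => [m w _ _|m _]; last exact: measurable_chaining_term.
by rewrite lee_fin chaining_term_ge0.
Qed.

(** There are 2^m increments with fourth moment at most K (L / 2^m)^2, and the weight turns 1/2^m
    into (125/128)^m. The sum over m is 128/3, whence the 43 used below. *)
Lemma expectation_chaining_term r L m : (0 <= L)%R ->
  \int[P]_w (chaining_term (path w) r L m)%:E <= (K * L ^+ 2 * (125 / 128) ^+ m)%:E.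
Proof.
move=> L0; rewrite /chaining_term.
under eq_integral do rewrite EFinM -sumEFin.
rewrite ge0_integralZl_EFin//; first last.
- by apply: emeasurable_sum => k; exact: measurable_increment4.
- by move=> w _; apply: sume_ge0 => k _; rewrite lee_fin exp4_ge0.
rewrite ge0_integral_sum//; first last.
- by move=> k w _; rewrite lee_fin exp4_ge0.
- by move=> k; exact: measurable_increment4.
have p0 : (0 < 2 ^+ m :> R)%R by rewrite exprn_gt0.
have h k : \int[P]_w (dyadic_increment (path w) r L m k ^+ 4)%:E <=
    (K * (L / 2 ^+ m) ^+ 2)%:E.
  have -> : (L / 2 ^+ m = (r + L * k.+1%:R / 2 ^+ m) - (r + L * k%:R / 2 ^+ m))%R.
    by rewrite -natr1; field; rewrite gt_eqF.
  apply: W_moment; rewrite lerD2l; apply: ler_wpM2r; first by rewrite invr_ge0 ltW.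
  by apply: ler_wpM2l => //; rewrite ler_nat.
apply: (@le_trans _ _ (((125 / 64) ^+ m)%:E *
    \sum_(k < 2 ^ m) (K * (L / 2 ^+ m) ^+ 2)%:E)).
  apply: lee_wpmul2l; first by rewrite lee_fin; apply: exprn_ge0; lra.
  by apply: lee_sum => k _; exact: h.
rewrite sumEFin -EFinM lee_fin sumr_const card_ord -[X in (_ * X <= _)%R]mulr_natr natrX.
have -> : ((125 / 128) ^+ m = (125 / 64) ^+ m / 2 ^+ m :> R)%R.
  by rewrite -exprVn -exprMn; congr (_ ^+ _)%R; field.
rewrite le_eqVlt; apply/orP; left; apply/eqP; field; rewrite gt_eqF//.
Qed.

Lemma expectation_chaining_sum r L : (0 <= L)%R ->
  \int[P]_w chaining_sum (path w) r L <= (43 * K * L ^+ 2)%:E.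
Proof.
move=> L0; rewrite integral_nneseries//; first last.
- by move=> m w _; rewrite lee_fin chaining_term_ge0.
- by move=> m; exact: measurable_chaining_term.
have KL : (0 <= K * L ^+ 2)%R by rewrite mulr_ge0// sqr_ge0.
apply: (@le_trans _ _ (\sum_(0 <= m <oo) (K * L ^+ 2 * (125 / 128) ^+ m)%:E)).
  apply: lee_nneseries => [m _|m _]; last exact: expectation_chaining_term.
  by move=> _; apply: integral_ge0 => w _; rewrite lee_fin chaining_term_ge0.
apply: (le_trans (nneseries_geometric_le KL _ _)); [lra|lra|].
rewrite lee_fin (_ : (1 - 125 / 128)^-1 = 128 / 3 :> R)%R; last by field.
by rewrite -(mulrA 43%R); move: (K * _)%R KL => q; lra.
Qed.

Lemma measurable_drift_bound n : measurable_fun setT (fun w => drift_bound (path w) n).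
Proof.
apply: emeasurable_funD => //; apply: ge0_emeasurable_sum => [k w _ _|k _].
  by rewrite mule_ge0// ?chaining_sum_ge0// lee_fin divr_ge0// ?mulr_ge0// exprn_ge0.
by apply: measurable_funeM; exact: measurable_chaining_sum.
Qed.

Lemma drift_bound_ge0 g n : 0 <= drift_bound g n :> \bar R.
Proof.
rewrite /drift_bound adde_ge0//; apply: nneseries_ge0 => k _ _.
by rewrite mule_ge0// ?chaining_sum_ge0// lee_fin divr_ge0// ?mulr_ge0// exprn_ge0.
Qed.

(** The expected chaining sum of a window of length 2^k is of order 4^k, against the factor 1/8^k;
    the series is geometric of ratio 1/2 and its bound is uniform in [n]. *)
Lemma expectation_drift_bound n :
  \int[P]_w drift_bound (path w) n <= (1 + 4 * 20 ^+ 3 * (43 * K))%:E.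
Proof.
have f0 k w : 0 <= (2 * 20 ^+ 3 / 8 ^+ k)%:E * chaining_sum (path w) (n.+1%:R - 2 ^+ k) (2 ^+ k).
  by rewrite mule_ge0// ?chaining_sum_ge0// lee_fin divr_ge0// ?mulr_ge0// exprn_ge0.
have mf k : measurable_fun setT (fun w =>
    (2 * 20 ^+ 3 / 8 ^+ k)%:E * chaining_sum (path w) (n.+1%:R - 2 ^+ k) (2 ^+ k)).
  by apply: measurable_funeM; exact: measurable_chaining_sum.
rewrite /drift_bound ge0_integralD//; first last.
- by apply: ge0_emeasurable_sum.
- by move=> w _; apply: nneseries_ge0.
rewrite integral_probability_cst integral_nneseries// EFinD; apply: leeD2l.
have c0 : (0 <= 2 * 20 ^+ 3 * (43 * K))%R by rewrite !mulr_ge0// exprn_ge0.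
have If k : \int[P]_w ((2 * 20 ^+ 3 / 8 ^+ k)%:E *
    chaining_sum (path w) (n.+1%:R - 2 ^+ k) (2 ^+ k)) <=
    (2 * 20 ^+ 3 * (43 * K) * (1 / 2) ^+ k)%:E.
  have k0 : (0 <= 2 * 20 ^+ 3 / 8 ^+ k :> R)%R.
    by rewrite divr_ge0// ?mulr_ge0// exprn_ge0.
  rewrite ge0_integralZl_EFin//; first last.
  - exact: measurable_chaining_sum.
  - by move=> w _; exact: chaining_sum_ge0.
  have p0 : (0 <= 2 ^+ k :> R)%R by rewrite exprn_ge0.
  have h := expectation_chaining_sum (n.+1%:R - 2 ^+ k) p0.
  apply: (le_trans (lee_wpmul2l _ h)); first by rewrite lee_fin.
  rewrite -EFinM lee_fin le_eqVlt; apply/orP; left; apply/eqP.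
  have -> : ((1 / 2) ^+ k = (2 ^+ k) ^+ 2 / 8 ^+ k :> R)%R.
    by rewrite -exprM mulnC exprM -exprVn -exprMn; congr (_ ^+ _)%R; field.
  by ring.
apply: (@le_trans _ _ (\sum_(0 <= k <oo) (2 * 20 ^+ 3 * (43 * K) * (1 / 2) ^+ k)%:E)).
  apply: lee_nneseries => [k _|k _]; last exact: If.
  by move=> _; apply: integral_ge0.
apply: (le_trans (nneseries_geometric_le c0 _ _)); [lra|lra|].
rewrite lee_fin (_ : (1 - 1 / 2)^-1 = 2 :> R)%R; last by field.
have -> : (4 * 20 ^+ 3 * (43 * K) = 2 * 20 ^+ 3 * (43 * K) * 2)%R by ring.
exact: lexx.
Qed.

End Moments.

(* The integral of a nonnegative function is a supremum over the simple functions
   below it, measurable or not; this spares the measurability of the inventory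
   level in time and in the sample point. *)
Lemma ge0_le_integral_nonmeasurable d (T : measurableType d) (R : realType)
    (mu : {measure set T -> \bar R}) (D : set T) (f1 f2 : T -> \bar R) :
  (forall x, D x -> 0 <= f1 x)%E -> (forall x, D x -> f1 x <= f2 x)%E ->
  (\int[mu]_(x in D) f1 x <= \int[mu]_(x in D) f2 x)%E.
Proof.
move=> f10 f12; have f20 x : D x -> (0 <= f2 x)%E.
  by move=> Dx; rewrite (le_trans (f10 x Dx))// f12.
rewrite !ge0_integralE//; apply: le_ereal_sup => _ [h hf <-]; exists h => // x.
apply: (le_trans (hf x)); rewrite /patch; case: ifPn => // /set_mem.
exact: f12.
Qed.

(** * A pathwise bound on the costs up to a horizon *)

Section PathBound.
Context {R : realType} {T : Type}.
Variables (W : R -> T -> R) (w : T).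
Hypothesis W0 : W 0 w = 0.
Hypothesis Wc : {within [set t : R | 0 <= t], continuous (W ^~ w)}.
Let g : R -> R := fun t => W (Order.max 0 t) w.

Let gE t : 0 <= t -> g t = W t w.
Proof. by move=> t0; rewrite /g max_r. Qed.

Let gc : continuous g.
Proof. exact: (@extended_path_continuous _ (W ^~ w) Wc). Qed.

Let g0 : g 0 = 0.
Proof. by rewrite gE. Qed.

(** By [sup_pow4_le] one may take ws^4 = 2 * 10^3 v, and then ws^2 <= (h + ws^4 / h) / 2. Since v
    has expectation of order h^2, this makes ws^2 of order h. *)
Lemma sup_bound (h v : R) : 1 <= h -> chaining_sum g 0 h = v%:E ->
  exists ws, [/\ 0 <= ws, forall u : R, 0 <= u -> u <= h -> `|W u w| <= ws &
    ws ^+ 2 <= h / 2 + 10 ^+ 3 * v / h].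
Proof.
move=> h1 E; have h0 : 0 < h by apply: lt_le_trans h1.
have v0 : 0 <= v by have := chaining_sum_ge0 g 0 h; rewrite E lee_fin.
have v2 : 0 <= 2 * 10 ^+ 3 * v by rewrite !mulr_ge0// exprn_ge0.
exists (Num.sqrt (Num.sqrt (2 * 10 ^+ 3 * v))).
have q2 : Num.sqrt (2 * 10 ^+ 3 * v) ^+ 2 = 2 * 10 ^+ 3 * v by rewrite sqr_sqrtr.
have w2 : Num.sqrt (Num.sqrt (2 * 10 ^+ 3 * v)) ^+ 2 = Num.sqrt (2 * 10 ^+ 3 * v).
  by rewrite sqr_sqrtr// sqrtr_ge0.
split; first exact: sqrtr_ge0.
  move=> u u0 uh; rewrite -gE//.
  rewrite -(@ler_pXn2r _ 4)// ?nnegrE ?sqrtr_ge0//.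
  rewrite [leRHS](exprM _ 2 2) w2 q2.
  exact: sup_pow4_le gc g0 h0 E u0 uh.
rewrite w2; move: (Num.sqrt _) q2 => q q2.
have : 0 <= (q - h) ^+ 2 / h by rewrite divr_ge0 ?sqr_ge0// ltW.
have -> : (q - h) ^+ 2 / h = q ^+ 2 / h - 2 * q + h by field; rewrite gt_eqF.
rewrite q2 (_ : 2 * 10 ^+ 3 * v / h = 2 * (10 ^+ 3 * v / h)); last by ring.
by move: (10 ^+ 3 * v / h) => z; lra.
Qed.

(** Dominates, up to constant factors, both the ordering cost and the integral of |X| up to time
    [h]. The constants 31 and 9 come from the final arithmetic of [inventory_integral_le]. *)
Definition path_bound (h : R) : \bar R :=
  ((31 * h)%:E + (9 * 10 ^+ 3 / h)%:E * chaining_sum g 0 h +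
   \sum_(n < (Num.truncn h).+1) drift_bound g n)%E.

Lemma path_bound_ge0 h : 0 <= h -> (0 <= path_bound h)%E.
Proof.
move=> h0; rewrite /path_bound adde_ge0// ?adde_ge0//.
- by rewrite lee_fin mulr_ge0.
- by rewrite mule_ge0 ?chaining_sum_ge0// lee_fin divr_ge0// mulr_ge0// exprn_ge0.
- by apply: sume_ge0 => n _; exact: drift_bound_ge0.
Qed.

Lemma path_bound_ge h (x : \bar R) : 1 <= h ->
  (forall v ws : R, 0 <= v -> 0 <= ws ->
     (forall u : R, 0 <= u -> u <= h -> `|W u w| <= ws) ->
     ws ^+ 2 <= h / 2 + 10 ^+ 3 * v / h ->
     (x <= (31 * h + 9 * (10 ^+ 3 * v / h))%:E + \sum_(n < (Num.truncn h).+1) drift_bound g n)%E) ->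
  (x <= path_bound h)%E.
Proof.
move=> h1 H; have h0 : 0 < h by apply: lt_le_trans h1.
have c0 : 0 < 9 * 10 ^+ 3 / h by rewrite divr_gt0// mulr_gt0// exprn_gt0.
have s0 : (0 <= \sum_(n < (Num.truncn h).+1) drift_bound g n)%E.
  by apply: sume_ge0 => n _; exact: drift_bound_ge0.
rewrite /path_bound.
case E : (chaining_sum g 0 h) (chaining_sum_ge0 g 0 h) => [v||] // v0; last first.
  rewrite gt0_muley ?lte_fin// addey// addye ?leey//.
  by rewrite gt_eqF// (lt_le_trans _ s0)// ltNy0.
have [ws [ws0 hws ws2]] := sup_bound h1 E.
have := H v ws v0 ws0 hws ws2.
rewrite -EFinM -EFinD (_ : 9 * (10 ^+ 3 * v / h) = 9 * 10 ^+ 3 / h * v)//.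
by ring.
Qed.

Lemma ordering_cost_le_path_bound (h k1 : R) : 1 <= h -> 0 <= k1 ->
  (\sum_(0 <= k <oo) (if order_time W k w <= h%:E
     then (c1 k1 (order_levels W k w))%:E else 0) <=
   (4 * k1 + 2)%:E * path_bound h)%E.
Proof.
move=> h1 k10; have h0 : 0 < h by apply: lt_le_trans h1.
set S := (\sum_(_ <= _ <oo) _)%E.
have c0 : 0 < 4 * k1 + 2 by lra.
suff : (((4 * k1 + 2)^-1)%:E * S <= path_bound h)%E.
  by rewrite lee_pdivrMl.
apply: path_bound_ge => // v ws v0 ws0 hws ws2.
rewrite lee_pdivrMl//.
apply: le_trans (ordering_cost_le W0 Wc (ltW h0) hws k10) _.
rewrite EFinM; apply: lee_wpmul2l; first by rewrite lee_fin ltW.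
apply: (@le_trans _ _ (31 * h + 9 * (10 ^+ 3 * v / h))%:E).
  have : 0 <= 10 ^+ 3 * v / h by rewrite divr_ge0 ?mulr_ge0 ?exprn_ge0// ltW.
  rewrite lee_fin; move: ws2; move: (10 ^+ 3 * v / h) => z ws2 z0.
  have := sqr_ge0 (ws - 1); rewrite sqrrB1; lra.
by rewrite leeDl//; apply: sume_ge0 => n _; exact: drift_bound_ge0.
Qed.

(** The bound of [inventory_le] is integrated: each large filling contributes its size times the
    length of its interval, and the drift term is bounded by [drift_bound] on each [n, n + 1]. A
    general [F] covers both the holding cost and the indicator in Markov's inequality. *)
Lemma inventory_integral_le (h c : R) (F : R -> R) : 1 <= h -> 0 < c ->
  (forall s, 0 <= F s) -> (forall s, F s <= c * `|inventory W s w|) ->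
  (\int[lebesgue_measure]_(s in `[0%R, h]) (F s)%:E <= c%:E * path_bound h)%E.
Proof.
move=> h1 c0 F0 FX; have h0 : 0 < h by apply: lt_le_trans h1.
rewrite -lee_pdivrMl//; apply: path_bound_ge => // v ws v0 ws0 hws ws2.
rewrite lee_pdivrMl//.
have [E [hE bd]] := inventory_le W0 Wc (ltW h0) hws.
set N := (Num.truncn h).+1.
pose I e := `[big_level e - ws, big_level e + big_size e + ws]%classic : set R.
pose J (n : nat) := `[n%:R, n.+1%:R]%classic : set R.
pose f1 (s : R) : \bar R := (\sum_(e < E) (big_size e : R)%:E * (\1_(I e) s)%:E)%E.
pose f2 (s : R) : \bar R := (\sum_(n < N) drift_bound g n * (\1_(J n) s)%:E)%E.
have mI e : measurable (I e) by exact: measurable_itv.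
have mJ n : measurable (J n) by exact: measurable_itv.
have i0 (A : set R) s : (0 <= (\1_A s)%:E :> \bar R)%E by rewrite lee_fin.
have f10 s : (0 <= f1 s)%E.
  by apply: sume_ge0 => e _; rewrite mule_ge0// lee_fin ltW// big_size_gt0.
have f20 s : (0 <= f2 s)%E.
  by apply: sume_ge0 => e _; rewrite mule_ge0// drift_bound_ge0.
have mi (D A : set R) : measurable A -> measurable_fun D (fun s => (\1_A s)%:E : \bar R).
  by move=> mA; apply/measurable_EFinP; exact: measurable_indic.
have mf1 (D : set R) : measurable_fun D f1.
  by apply: emeasurable_sum => e; apply: measurable_funeM; exact: mi.
have mf2 (D : set R) : measurable_fun D f2.
  by apply: emeasurable_sum => e; apply: measurable_funeM; exact: mi.
have mD : measurable (`[0, h]%classic : set R) by exact: measurable_itv.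
have len A : measurable A -> (\int[lebesgue_measure]_(s in `[0%R, h]) (\1_A s)%:E <=
    lebesgue_measure (A : set R))%E.
  move=> mA; rewrite integral_indic//; apply: le_measure; rewrite ?inE//.
  exact: measurableI.
have mf (D : set R) : measurable_fun D (fun s => 1 + (f1 s + f2 s))%E.
  by apply: emeasurable_funD => //; exact: (emeasurable_funD (mf1 _) (mf2 _)).
apply: (@le_trans _ _
    (\int[lebesgue_measure]_(s in `[0%R, h]) (c%:E * (1 + (f1 s + f2 s))))%E).
  apply: ge0_le_integral_nonmeasurable => [s _|s]; first by rewrite lee_fin.
  rewrite /= in_itv /= => /andP[s0 sh].
  apply: (@le_trans _ _ (c%:E * (`|inventory W s w|)%:E)%E).
    by rewrite -EFinM lee_fin.
  apply: lee_wpmul2l; first by rewrite lee_fin ltW.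
  have [u [u0 us hX]] := bd s s0 sh.
  pose n := Num.truncn s.
  have /andP[ns sn] := truncn_itv s0.
  have nN : (n < N)%N by rewrite ltnS; exact: le_truncn.
  have hd : ((W s w - W u w - (s - u))%:E <= f2 s)%E.
    rewrite -(gE s0) -(gE u0).
    apply: (@le_trans _ _ (drift_bound g n)).
      by apply: drift_bound_ge => //; apply/andP; split => //; exact: ltW.
    rewrite /f2 (bigD1 (Ordinal nN))//= indicE mem_set ?mule1; last first.
      by rewrite /J /= in_itv /= ns ltW.
    by rewrite leeDl//; apply: sume_ge0 => e _; rewrite mule_ge0// drift_bound_ge0.
  rewrite addeA; apply: le_trans (leeD2l _ hd).
  rewrite /f1; under eq_bigr do rewrite -EFinM.
  by rewrite sumEFin -!EFinD lee_fin.
rewrite ge0_integralZl//; first last.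
- by rewrite lee_fin ltW.
- by move=> s _; rewrite !adde_ge0.
- exact: mf.
apply: lee_wpmul2l; first by rewrite lee_fin ltW.
rewrite ge0_integralD//; first last.
- exact: (emeasurable_funD (mf1 _) (mf2 _)).
- by move=> s _; rewrite adde_ge0.
rewrite ge0_integralD//; [|exact: mf1|exact: mf2].
have -> : (\int[lebesgue_measure]_(s in `[0%R, h]) 1 = h%:E :> \bar R)%E.
  have lh : (1 * lebesgue_measure (`[0%R, h]%classic : set R) = h%:E :> \bar R)%E.
    by rewrite mul1e lebesgue_measure_itv/= lte_fin h0 -EFinD subr0.
  exact: etrans (integral_cst (@lebesgue_measure R) mD 1%E) lh.
have If1 : (\int[lebesgue_measure]_(s in `[0%R, h]) f1 s <=
    (\sum_(e < E) (big_size e * (big_size e + 2 * ws)))%:E)%E.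
  rewrite /f1 ge0_integral_sum//; first last.
  - by move=> e s _; rewrite mule_ge0// lee_fin ltW// big_size_gt0.
  - by move=> e; apply: measurable_funeM; exact: mi.
  rewrite -sumEFin; apply: lee_sum => e _.
  have b0 : (0 <= (big_size e)%:E :> \bar R)%E by rewrite lee_fin ltW// big_size_gt0.
  rewrite ge0_integralZl//; last exact: mi.
  rewrite EFinM; apply: lee_wpmul2l => //.
  apply: le_trans (len _ (mI e)) _; rewrite lebesgue_measure_itv/=.
  have := big_size_gt0 (R:=R) e => be.
  case: ifPn => _; last by rewrite lee_fin; lra.
  by rewrite -EFinD lee_fin; lra.
have If2 : (\int[lebesgue_measure]_(s in `[0%R, h]) f2 s <=
    \sum_(n < N) drift_bound g n)%E.
  rewrite /f2 ge0_integral_sum//; first last.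
  - by move=> e s _; rewrite mule_ge0// drift_bound_ge0.
  - by move=> e; apply: measurable_funeM; exact: mi.
  apply: lee_sum => n _.
  rewrite ge0_integralZl// ?drift_bound_ge0//; last exact: mi.
  rewrite -[leRHS]mule1; apply: lee_wpmul2l; first exact: drift_bound_ge0.
  apply: le_trans (len _ (mJ n)) _; rewrite lebesgue_measure_itv/=.
  case: ifPn => _ //; rewrite -EFinD lee_fin -natr1; lra.
rewrite addeA; apply: leeD; last exact: If2.
apply: (le_trans (leeD2l _ If1)); rewrite -EFinD lee_fin.
have S1 : \sum_(e < E) (big_size e * (big_size e + 2 * ws)) <=
    2 ^+ E + 8 * big_size E * ws :> R.
  under eq_bigr do rewrite mulrDr -expr2 big_size_sqr.
  rewrite big_split /= -mulr_suml; apply: lerD.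
    have := subrX1 (2 : R) E; move: (\sum_(_ < _) _) => z; lra.
  have -> : 8 * big_size E * ws = 4 * big_size E * (2 * ws) :> R by ring.
  by apply: ler_wpM2r; [rewrite mulr_ge0|exact: sum_big_size].
(* As 2 [big_size E] ws <= 2^E + ws^2, the terms other than the drift are at most h + 5 * 2^E + 4
   ws^2. With 2^E <= 2 (h + ws + 1) and 2 ws <= ws^2 + 1 this is at most 11 h + 15 + 9 ws^2, hence
   at most 31 h + 9 (10^3 v / h) because h >= 1. *)
have := sqr_ge0 (big_size E - ws); rewrite sqrrB big_size_sqr.
have := sqr_ge0 (ws - 1); rewrite sqrrB1.
have : 0 <= 10 ^+ 3 * v / h by rewrite divr_ge0 ?mulr_ge0 ?exprn_ge0// ltW.
move: ws2 S1 hE; move: (10 ^+ 3 * v / h) => z ws2 S1 hE.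
rewrite -mulrA in S1; move: S1; move: (big_size E * ws) (\sum_(_ < _) _) (2 ^+ E) hE => x y z'.
lra.
Qed.

End PathBound.

(** * Expected path bound, linear in the horizon *)

Section Expectation.
Context {R : realType} d (T : measurableType d) (P : probability T R).
Local Open Scope ereal_scope.

Section FourthMomentProcess.
Variables (W : R -> T -> R) (K : R).
Hypothesis mW : forall t, measurable_fun setT (W t).
Hypothesis K_ge0 : (0 <= K)%R.
Hypothesis W_moment : forall s t : R, (0 <= s)%R -> (s <= t)%R ->
  \int[P]_w ((W t w - W s w) ^+ 4)%:E <= (K * (t - s) ^+ 2)%:E.

(** The windows of [drift_bound] may start at negative times. Freezing the process there keeps the
    moment bound, since t -> max 0 t does not increase distances. *)
Let V (t : R) : T -> R := W (Order.max 0 t)%R.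

Let mV t : measurable_fun setT (V t).
Proof. exact: mW. Qed.

Let V_moment s t : (s <= t)%R ->
  \int[P]_w ((V t w - V s w) ^+ 4)%:E <= (K * (t - s) ^+ 2)%:E.
Proof.
move=> st; have s0 : (0 <= Order.max 0 s)%R by rewrite le_max lexx.
have mst : (Order.max 0 s <= Order.max 0 t)%R by rewrite ge_max !le_max lexx st orbT.
apply: (le_trans (W_moment s0 mst)); rewrite lee_fin; apply: ler_wpM2l => //.
apply: lerXn2r; rewrite ?nnegrE ?subr_ge0//.
by case: (leP 0%R s) => hs; case: (leP 0%R t) => ht; lra.
Qed.

Lemma measurable_path_bound h : measurable_fun setT (fun w => path_bound W w h).
Proof.
apply: emeasurable_funD.
  apply: emeasurable_funD => //; apply: measurable_funeM.
  exact: (measurable_chaining_sum mV).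
by apply: emeasurable_sum => n; exact: (measurable_drift_bound mV).
Qed.

Lemma expectation_path_bound h : (1 <= h)%R -> \int[P]_w path_bound W w h <=
  ((31 + 9 * 10 ^+ 3 * (43 * K) + 2 * (1 + 4 * 20 ^+ 3 * (43 * K))) * h)%:E.
Proof.
move=> h1; have h0 : (0 < h)%R by apply: lt_le_trans h1.
have c0 : (0 <= 9 * 10 ^+ 3 / h)%R.
  by rewrite divr_ge0 ?mulr_ge0 ?exprn_ge0// ltW.
have mc := measurable_chaining_sum mV 0%R h.
have md n := measurable_drift_bound mV n.
have d0 n w := drift_bound_ge0 (V^~ w) n.
have cs0 w : 0 <= (9 * 10 ^+ 3 / h)%:E * chaining_sum (V^~ w) 0 h.
  by rewrite mule_ge0// chaining_sum_ge0.
have m1 : measurable_fun setT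
    (fun w => (9 * 10 ^+ 3 / h)%:E * chaining_sum (V^~ w) 0 h).
  exact: measurable_funeM.
have m2 : measurable_fun setT
    (fun w => \sum_(n < (Num.truncn h).+1) drift_bound (V^~ w) n).
  by apply: emeasurable_sum => n; exact: md.
have h31 : (0 <= 31 * h)%R by rewrite mulr_ge0// ltW.
rewrite /path_bound ge0_integralD//; first last.
- by move=> w _; apply: sume_ge0 => n _; exact: d0.
- exact: emeasurable_funD.
- by move=> w _; apply: adde_ge0; [rewrite lee_fin|exact: cs0].
have -> : \int[P]_w ((31 * h)%:E + (9 * 10 ^+ 3 / h)%:E * chaining_sum (V^~ w) 0 h) =
    (31 * h)%:E + (9 * 10 ^+ 3 / h)%:E * \int[P]_w chaining_sum (V^~ w) 0 h.
  rewrite ge0_integralD//; congr (_ + _).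
    exact: integral_probability_cst.
  by rewrite ge0_integralZl// => w _; exact: chaining_sum_ge0.
have -> : \int[P]_w (\sum_(n < (Num.truncn h).+1) drift_bound (V^~ w) n) =
    \sum_(n < (Num.truncn h).+1) \int[P]_w drift_bound (V^~ w) n.
  by apply: ge0_integral_sum.
have e1 : (9 * 10 ^+ 3 / h)%:E * \int[P]_w chaining_sum (V^~ w) 0 h <=
    (9 * 10 ^+ 3 * (43 * K) * h)%:E.
  have e := expectation_chaining_sum mV K_ge0 V_moment 0%R (ltW h0).
  apply: (le_trans (lee_wpmul2l _ e)); first by rewrite lee_fin.
  rewrite -EFinM lee_fin le_eqVlt; apply/orP; left; apply/eqP.
  by field; rewrite gt_eqF.
have e2 : \sum_(n < (Num.truncn h).+1) \int[P]_w drift_bound (V^~ w) n <=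
    (2 * (1 + 4 * 20 ^+ 3 * (43 * K)) * h)%:E.
  apply: (@le_trans _ _ (\sum_(n < (Num.truncn h).+1) (1 + 4 * 20 ^+ 3 * (43 * K))%:E)).
    apply: lee_sum => n _; exact: (expectation_drift_bound mV K_ge0 V_moment).
  rewrite sumEFin lee_fin sumr_const card_ord -[leLHS]mulr_natr.
  have c1 : (0 <= 1 + 4 * 20 ^+ 3 * (43 * K))%R.
    by rewrite addr_ge0// !mulr_ge0// exprn_ge0.
  move: (1 + _)%R c1 => q c1.
  have -> : (2 * q * h = q * (2 * h))%R by ring.
  apply: ler_wpM2l => //.
  have : ((Num.truncn h)%:R <= h)%R by rewrite truncn_le ltW.
  by rewrite -natr1; lra.
have -> : ((31 + 9 * 10 ^+ 3 * (43 * K) + 2 * (1 + 4 * 20 ^+ 3 * (43 * K))) * h =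
    31 * h + 9 * 10 ^+ 3 * (43 * K) * h + 2 * (1 + 4 * 20 ^+ 3 * (43 * K)) * h)%R.
  by ring.
rewrite !EFinD; apply: leeD; last exact: e2.
exact: leeD2l.
Qed.

End FourthMomentProcess.

(** The Gaussian tail bound is used with deviation sqrt(t - s), whose fourth power is (t - s)^2. The
    case s = t is separate because the Gaussian law is given for s < t. *)
Lemma brownian_fourth_moment (W : R -> {RV P >-> R}) : standard_brownian_motion W ->
  exists K : R, (0 <= K)%R /\ forall s t : R, (0 <= s)%R -> (s <= t)%R ->
    \int[P]_w ((W t w - W s w) ^+ 4)%:E <= (K * (t - s) ^+ 2)%:E.
Proof.
move=> bm; have C0 : (0 <= 1024 :> R)%R by rewrite ler0n.
have tail := @normal_prob_tail R; move: 1024%R C0 tail => C C0 tail.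
exists (1 + 22 * C)%R; split; first by rewrite addr_ge0// mulr_ge0.
move=> s t s0; rewrite le_eqVlt => /predU1P[<-|st].
  under eq_integral do rewrite subrr expr0n /=.
  by rewrite integral0 subrr expr0n /= mulr0.
have ts : (0 < t - s)%R by rewrite subr_gt0.
have q0 : (0 < Num.sqrt (t - s))%R by rewrite sqrtr_gt0.
have mX : measurable_fun setT (fun w => W t w - W s w)%R by apply: measurable_funB.
have -> : ((t - s) ^+ 2 = Num.sqrt (t - s) ^+ 4)%R.
  by rewrite [RHS](exprM _ 2 2) sqr_sqrtr// ltW.
rewrite mulrC; apply: fourth_moment_le_tail => // a a0.
apply: le_trans (tail _ _ q0 a0).
have mA : measurable [set x : R | (a * Num.sqrt (t - s) <= `|x|)%R].
  by rewrite -[X in measurable X]setTI; apply: measurable_fun_le.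
by rewrite -(bm_gaussian bm s0 st mA).
Qed.

End Expectation.

(** * The three claims for the Brownian inventory *)

Section BrownianInventory.
Context {R : realType} d (Omega : measurableType d) (P : probability Omega R).
Variable W : R -> {RV P >-> R}.
Hypothesis W_bm : standard_brownian_motion W.

Let W0 w : W 0 w = 0.
Proof. exact: bm_start. Qed.

Let Wc w : {within [set t : R | 0 <= t], continuous (W ^~ w)}.
Proof. exact: bm_continuous. Qed.

Let mW t : measurable_fun setT (W t : Omega -> R).
Proof. by []. Qed.

Local Notation bound := (path_bound (fun t w => W t w)).

Lemma path_bound_linear : exists C : R, 0 < C /\
  forall h, 1 <= h -> (\int[P]_w bound w h <= (C * h)%:E)%E.
Proof.
have [K [K0 mom]] := brownian_fourth_moment W_bm.
eexists; split; last first.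
  by move=> h h1; exact: (expectation_path_bound mW K0 mom h1).
have : 0 <= 9 * 10 ^+ 3 * (43 * K) by rewrite !mulr_ge0// exprn_ge0.
have : 0 <= 4 * 20 ^+ 3 * (43 * K) by rewrite !mulr_ge0// exprn_ge0.
by move: (4 * 20 ^+ 3 * _) (9 * _ * _) => x y; lra.
Qed.

(** Serves (a), with [F] the total cost, and (b), with [F] the time spent outside a compact set. *)
Lemma average_le_path_bound (C h c : R) (F : Omega -> \bar R) :
  (forall h : R, 1 <= h -> (\int[P]_w bound w h <= (C * h)%:E)%E) ->
  1 <= h -> 0 < c -> (forall w, 0 <= F w)%E ->
  (forall w, F w <= c%:E * bound w h)%E ->
  ((h^-1)%:E * \int[P]_w F w <= (c * C)%:E)%E.
Proof.
move=> hC h1 c0 F0 FB; have h0 : 0 < h by apply: lt_le_trans h1.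
have b0 w : (0 <= bound w h)%E by apply: path_bound_ge0; exact: ltW.
apply: (@le_trans _ _ ((h^-1)%:E * \int[P]_w (c%:E * bound w h))%E).
  apply: lee_wpmul2l; first by rewrite lee_fin invr_ge0 ltW.
  by apply: ge0_le_integral_nonmeasurable.
rewrite ge0_integralZl//; last by rewrite lee_fin ltW.
  apply: (@le_trans _ _ ((h^-1)%:E * (c%:E * (C * h)%:E))%E).
    apply: lee_wpmul2l; first by rewrite lee_fin invr_ge0 ltW.
    apply: lee_wpmul2l; first by rewrite lee_fin ltW.
    exact: hC.
  rewrite -!EFinM lee_fin le_eqVlt; apply/orP; left; apply/eqP.
  by field; rewrite gt_eqF.
exact: (measurable_path_bound mW).
Qed.

Lemma ordering_cost_ge0 (t k1 : R) w : 0 <= k1 ->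
  (0 <= \sum_(0 <= k <oo) (if order_time W k w <= t%:E
     then (c1 k1 (order_levels W k w))%:E else 0))%E.
Proof.
move=> k10; apply: nneseries_ge0 => k _ _; case: ifPn => // h.
rewrite (@order_levelsE _ _ _ w (W0 w) (@Wc w) k t h) lee_fin /c1 /= addr_ge0//.
rewrite [total k.+1]/total big_ord_recr /= -/(total k).
by have := order_size_ge0 (R:=R) k; lra.
Qed.

Lemma long_term_average_cost_lty k1 : 0 < k1 ->
  (long_term_average_cost P (inventory W) (order_time W) (order_levels W) k1
    < +oo)%E.
Proof.
move=> k10; have [C [C0 hC]] := path_bound_linear.
apply: (@le_lt_trans _ _ ((4 * k1 + 4) * C)%:E); last exact: ltry.
rewrite /long_term_average_cost /limf_esup.
(* The upper limit is at most the supremum over t >= 1, the range where the path bound has linear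
   expectation. *)
apply: (@le_trans _ _ (ereal_sup ((fun t : R => (t^-1)%:E *
    \int[P]_w (\int[lebesgue_measure]_(s in `[0%R, t]) (c0 (inventory W s w))%:E +
               \sum_(0 <= k <oo)
                 (if order_time W k w <= t%:E
                  then (c1 k1 (order_levels W k w))%:E else 0)))%E @` [set t | 1 <= t]))).
  apply: ereal_inf_lbound; exists [set t | 1 <= t] => //.
  exact: nbhs_pinfty_ge.
apply: ge_ereal_sup => _ [t /= t1 <-].
have t0 : 0 < t by apply: lt_le_trans t1.
apply: average_le_path_bound => //; first lra.
  move=> w; apply: adde_ge0; last by apply: ordering_cost_ge0; exact: ltW.
  by apply: integral_ge0 => s _; rewrite lee_fin /c0 mulr_ge0.
move=> w.
have -> : (4 * k1 + 4 = 2 + (4 * k1 + 2)) by ring.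
rewrite EFinD ge0_muleDl ?lee_fin//; last by lra.
apply: leeD; last by apply: ordering_cost_le_path_bound => //; exact: ltW.
by apply: inventory_integral_le => // s; rewrite /c0 ?mulr_ge0.
Qed.

Lemma occupation_measure_tight : tight_at_infinity (occupation_measure P (inventory W)).
Proof.
move=> eps eps0; have [C [C0 hC]] := path_bound_linear.
(* Markov's inequality: the indicator of |X| > A is at most |X| / A, so the averaged measure is at
   most C / A = eps / 2. *)
pose A := 2 * C / eps; have A0 : 0 < A by rewrite divr_gt0// mulr_gt0.
exists `[- A, A]%classic, 1; split; first exact: segment_compact.
move=> t _ t1; rewrite /occupation_measure.
apply: (@le_lt_trans _ _ (A^-1 * C)%:E); last first.
  have -> : A^-1 * C = eps / 2.
    by rewrite /A; field; rewrite !gt_eqF.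
  by rewrite lte_fin; lra.
apply: average_le_path_bound => //; first by rewrite invr_gt0.
  by move=> w; apply: integral_ge0 => s _; rewrite lee_fin.
move=> w; apply: inventory_integral_le => //; first by rewrite invr_gt0.
move=> s; rewrite indicE; case: (boolP (_ \in _)) => [|_]; last first.
  by rewrite mulr_ge0// invr_ge0 ltW.
rewrite inE /= in_itv /= => hs; rewrite mulrC ler_pdivlMr// mul1r.
by rewrite leNgt; apply/negP => /ltW; rewrite ler_norml.
Qed.

(** On the complement W t > t / 2, hence W t ^ 4 > t^4 / 16. Markov's inequality bounds its
    probability by 16 K / t^2, at most 1/2 since 32 K <= t <= t^2. *)
Lemma low_level_probability (K t : R) : 0 <= K ->
  (forall s t : R, 0 <= s -> s <= t ->
    (\int[P]_w ((W t w - W s w) ^+ 4)%:E <= (K * (t - s) ^+ 2)%:E)%E) ->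
  1 <= t -> 32 * K <= t -> ((1 / 2)%:E <= P [set w | t / 2 <= t - W t w]%R)%E.
Proof.
move=> K0 mom t1 tK; have t0 : 0 < t by apply: lt_le_trans t1.
set A := [set w | _].
have mA : measurable A.
  rewrite -[A]setTI; apply: measurable_fun_le => //.
  exact: measurable_funB.
have m4 : measurable_fun setT (fun w => (W t w ^+ 4)%:E).
  by apply/measurable_EFinP/measurable_funX.
suff PA : (P (~` A) <= (1 / 2)%:E)%E.
  have e := probability_setC P mA; move: PA; rewrite e.
  have /fineK <- : P A \is a fin_num by exact: fin_num_measure.
  by rewrite -EFinB !lee_fin; lra.
have c0 : 0 <= 16 / t ^+ 4 by rewrite divr_ge0// exprn_ge0// ltW.
have -> : P (~` A) = (\int[P]_w (\1_(~` A) w)%:E)%E.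
  by rewrite integral_indic ?setIT//; exact: measurableC.
apply: (@le_trans _ _ (\int[P]_w ((16 / t ^+ 4)%:E * (W t w ^+ 4)%:E))%E).
  apply: ge0_le_integral_nonmeasurable => [w _|w _]; first by rewrite lee_fin.
  rewrite -EFinM lee_fin indicE; case: (boolP (_ \in _)) => [|_]; last first.
    by rewrite mulr_ge0// exp4_ge0.
  rewrite inE /A /= => /negP; rewrite -ltNge => hw.
  have : (t / 2) ^+ 4 <= W t w ^+ 4.
    by apply: lerXn2r; rewrite ?nnegrE; lra.
  rewrite mulrAC ler_pdivlMr ?exprn_gt0// mul1r.
  have -> : (t / 2) ^+ 4 = t ^+ 4 / 16 by field.
  by lra.
rewrite ge0_integralZl//; first last.
  by move=> w _; rewrite lee_fin exp4_ge0.
have h : (\int[P]_w (W t w ^+ 4)%:E <= (K * t ^+ 2)%:E)%E.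
  have := mom 0 t (lexx 0) (ltW t0); rewrite subr0; apply: le_trans.
  rewrite le_eqVlt; apply/orP; left; apply/eqP; apply: eq_integral => w _.
  congr (_ ^+ 4)%:E; apply: esym.
  exact: etrans (congr1 (fun x => W t w - x) (W0 w)) (subr0 _).
apply: (@le_trans _ _ ((16 / t ^+ 4)%:E * (K * t ^+ 2)%:E)%E).
  by apply: lee_wpmul2l.
rewrite -EFinM lee_fin (_ : 16 / t ^+ 4 * (K * t ^+ 2) = 16 * K / t ^+ 2); last first.
  by field; rewrite gt_eqF.
rewrite ler_pdivrMr ?exprn_gt0//.
have : t <= t ^+ 2 by rewrite expr2 ler_peMr// ltW.
by lra.
Qed.

Lemma compact_norm_bound (G : set (R * R)) : compact G ->
  exists M : R, forall yz, G yz -> `|yz.1| <= M.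
Proof.
move=> /compact_bounded [M [_ hM]]; exists (M + 1) => yz Gyz.
have M1 : M < M + 1 by rewrite ltrDl.
by apply: le_trans (hM _ M1 yz Gyz); rewrite prod_normE le_max lexx.
Qed.

Lemma big_size_unbounded (M : R) : exists e0, forall e, (e0 <= e)%N -> M < big_size e.
Proof.
exists (Num.truncn (M ^+ 2)).+1 => e he.
have [M0|M0] := ltP M 0; first by rewrite (lt_trans M0)// big_size_gt0.
rewrite -(@ltr_pXn2r _ 2)// ?nnegrE ?(ltW (big_size_gt0 _))// big_size_sqr.
rewrite (lt_le_trans (truncnS_gt _))// -natrX ler_nat (leq_trans he)//.
by rewrite ltnW// ltn_expl.
Qed.

(** The 0-size orders of cycle [e] occupy the consecutive positions 2^e + 2 to 2^(e+1) + 1. *)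
Lemma zero_orders (e : nat) : exists k0, forall i, (i < 2 ^ e)%N ->
  [/\ simultaneous_order (k0 + i), level (k0 + i) = big_level e :> R &
      filling (k0 + i) = big_size e :> R].
Proof.
have [||k0 [ck pk]] := @order_at e (2 ^ e).+2; first by [].
  by rewrite expnS; have : (0 < 2 ^ e)%N by [rewrite expn_gt0]; lia.
exists k0 => i.
suff h : (i < 2 ^ e)%N -> cycle (k0 + i) = e /\ position (k0 + i) = ((2 ^ e).+2 + i)%N.
  move=> /h[c p]; rewrite simultaneous_orderE /level /filling c p.
  have -> : ((2 ^ e).+2 + i <= 2 ^ e)%N = false by lia.
  by split => //; lia.
elim: i => [|i IH] hi; first by rewrite !addn0.
have [c p] := IH (ltnW hi).
have := cycle_positionS (k0 + i); rewrite c p.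
have -> : ((2 ^ e).+2 + i < 2 ^ e.+1 + 1)%N by rewrite expnS; lia.
by rewrite !addnS.
Qed.

Lemma ordering_measure_not_tight :
  not_tight_on Rbar_set (ordering_measure P (order_time W) (order_levels W)).
Proof.
have [K [K0 mom]] := brownian_fourth_moment W_bm.
(* With probability at least 1/2, 2^e orders lie outside the compact set by time 10 * 2^e, which
   gives mass at least 1/20; any smaller constant makes the inequality strict. *)
exists (1 / 40); split; first by rewrite divr_gt0.
move=> G Gc GR; have [M hM] := compact_norm_bound Gc.
have [e0 he0] := big_size_unbounded M.
(* Large enough for [big_size e] to exceed the first coordinates in [G] and for 32 K <= 2^e. *)
pose e := maxn e0 (Num.truncn (32 * K)).+1.
have bM : M < big_size e by apply: he0; rewrite leq_maxl.
have eK : 32 * K <= 2 ^+ e.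
  apply/ltW/(lt_le_trans (truncnS_gt _)); rewrite -natrX ler_nat.
  by rewrite (leq_trans (leq_maxr e0 _))// ltnW// ltn_expl.
have p1 : 1 <= 2 ^+ e :> R by rewrite exprn_ege1// ler1n.
(* Then t / 2 = 5 * 2^e exceeds [big_level e], which is at most 3 * 2^e by [cycle_start_le]. *)
pose t : R := 10 * 2 ^+ e.
have t0 : 0 < t by rewrite /t; lra.
exists t; split => //.
pose A := [set w | t / 2 <= t - W t w].
have PA : ((1 / 2)%:E <= P A)%E.
  by apply: (low_level_probability K0 mom); rewrite /t; lra.
have mA : measurable A.
  rewrite -[A]setTI; apply: measurable_fun_le => //.
  exact: measurable_funB.
have [k0 hk] := zero_orders e.
have lower w : ((2 ^+ e : R)%:E * (\1_A w : R)%:E <= \sum_(0 <= k <oo)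
    (if order_time W k w <= t%:E
     then (\1_(Rbar_set `\` G) (order_levels W k w))%:E else 0))%E.
  pose u k : \bar R := (if order_time W k w <= t%:E
    then (\1_(Rbar_set `\` G) (order_levels W k w))%:E else 0)%E.
  change ((2 ^+ e : R)%:E * (\1_A w : R)%:E <= \sum_(0 <= k <oo) u k)%E.
  have u0 k : (0 <= u k)%E by rewrite /u; case: ifP; rewrite ?lee_fin.
  rewrite indicE; case: (boolP (_ \in _)) => [|_]; last first.
    by rewrite mule0 nneseries_ge0.
  rewrite inE /A /= => wA; rewrite mule1.
  apply: le_trans (nneseries_lim_ge (k0 + 2 ^ e)%N _) => //.
  rewrite (@big_cat_nat _ _ _ k0)//= ?leq_addr//.
  rewrite -[leLHS]add0e; apply: leeD; first exact: sume_ge0.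
  rewrite -{1}[k0]add0n (addnC k0) big_addn addnK big_mkord.
  have -> : (2 ^+ e)%:E = (\sum_(i < 2 ^ e) 1%:E : \bar R)%E.
    by rewrite sumEFin sumr_const card_ord natrX.
  apply: lee_sum => i _; rewrite addnC.
  have [sim lv fl] := hk i (ltn_ord i).
  have ot : (order_time W (k0 + i) w <= t%:E)%E.
    apply/(order_time_le (W0 w) (@Wc w)); apply: (reached_IVT (W0 w) (@Wc w)).
    - exact: ltW.
    - exact: level_ge0.
    - rewrite lv (le_trans _ wA)// /big_level /t.
      by have := cycle_start_le (R:=R) e; lra.
  rewrite /u ot (@order_levelsE _ _ _ w (W0 w) (@Wc w) _ _ ot) lee_fin.
  have tk : total (k0 + i) = total (k0 + i).+1 :> R.
    rewrite [RHS]/total big_ord_recr /= -/(total (k0 + i)) order_sizeE.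
    move: sim; rewrite simultaneous_orderE => sim.
    by rewrite leqNgt (ltn_trans _ sim)// gtn_eqF// addr0.
  rewrite tk totalS addrAC subrr add0r fl indicE mem_set//; split.
    by rewrite /Rbar_set /=.
  by move=> /hM /=; rewrite leNgt ger0_norm ?bM// ltW// big_size_gt0.
rewrite /ordering_measure.
apply: (@lt_le_trans _ _ ((t^-1)%:E * \int[P]_w ((2 ^+ e)%:E * (\1_A w)%:E))%E); last first.
  apply: lee_wpmul2l; first by rewrite lee_fin invr_ge0 ltW.
  by apply: ge0_le_integral_nonmeasurable.
have mi : measurable_fun setT (fun w => (\1_A w)%:E : \bar R).
  by apply/measurable_EFinP; exact: measurable_indic.
rewrite ge0_integralZl//.
rewrite integral_indic// setIT.
apply: (@lt_le_trans _ _ ((t^-1)%:E * ((2 ^+ e)%:E * (1 / 2)%:E))%E).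
  rewrite -!EFinM lte_fin (_ : t^-1 * (2 ^+ e * (1 / 2)) = 1 / 20); first by lra.
  by rewrite /t; field; rewrite gt_eqF//; lra.
apply: lee_wpmul2l; first by rewrite lee_fin invr_ge0 ltW.
by apply: lee_wpmul2l; first by rewrite lee_fin exprn_ge0.
Qed.

End BrownianInventory.

Theorem theorem3p2 (R : realType) (d : measure_display)
    (Omega : measurableType d) (P : probability Omega R)
    (W : R -> {RV P >-> R}) (B : nat -> R -> {RV P >-> R}) (k1 : R)
    (W_bm : standard_brownian_motion W)
    (B_bm : forall k, standard_brownian_motion (B k))
    (B_indep : mutually_independent P (fun k => sigma_of_process (B k)))
    (X_pieces : pieced_together W B)
    (k1_gt0 : 0 < k1) :
  let X := inventory W in
  let tau := order_time W in
  let levels := order_levels W in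
  [/\ (long_term_average_cost P X tau levels k1 < +oo)%E,
      tight_at_infinity (occupation_measure P X) &
      not_tight_on Rbar_set (ordering_measure P tau levels)].
Proof.
split.
- exact: long_term_average_cost_lty.
- exact: occupation_measure_tight.
- exact: ordering_measure_not_tight.
Qed.
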